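(* Let $d\ge1$, $D>0$, $m\in(0,1)$, and define the measures $d\mu=V_D^{2-m}dx$, $d\nu=V_D\,dx$ on $\mathbb R^d$. (a) If $1\le d\le4$, or if $d\ge5$ and $m\in(m_*,1)$, then $\mu$ is finite and there exists a constant $\mathcal C_{m,d}>0$, independent of $D$, such that $$\int_{\mathbb R^d}|g-\bar g|^2d\mu\le\mathcal C_{m,d}\int_{\mathbb R^d}|\nabla g|^2d\nu\quad\forall g\in C_c^\infty(\mathbb R^d),\qquad \bar g=\frac{\int g\,d\mu}{\int d\mu}.$$ (b) If $d\ge5$ and $m\in(0,m_* )$, then $$\int_{\mathbb R^d}g^2d\mu\le\mathcal C_{m,d}\int_{\mathbb R^d}|\nabla g|^2d\nu\quad\forall g\in C_c^\infty(\mathbb R^d)$$ with $\mathcal C_{m,d}=\frac{8m(1-m)}{[(d-2)(m-m_* )]^2}$, and this constant is optimal.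
   Context: $m_*=(d-4)/(d-2)$ (for $d\ge3$). $V_D(x)=\big(D+\frac{1-m}{2m}|x|^2\big)^{-1/(1-m)}$, $x\in\mathbb R^d$. *)

(* Defs.v *)
From HB Require Import structures.
From mathcomp Require Import all_boot all_order all_algebra.
From mathcomp Require Import all_classical all_reals all_analysis.
Set Implicit Arguments. Unset Strict Implicit. Unset Printing Implicit Defensive.
Import Order.TTheory GRing.Theory Num.Theory.
Import numFieldNormedType.Exports.
Local Open Scope classical_set_scope.
Local Open Scope ring_scope.

Section Defs.
Variable R : realType.

Definition cons_rv (n : nat) (x : R) (y : 'rV[R]_n) : 'rV[R]_n.+1 :=
  \row_(i < n.+1) match unlift ord0 i with Some j => y ord0 j | None => x end.

(* Lebesgue integral over R^n, realised as the iterated one-dimensional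
   Lebesgue integral (Fubini/Tonelli). *)
Fixpoint iint (n : nat) : ('rV[R]_n -> \bar R) -> \bar R :=
  match n return ('rV[R]_n -> \bar R) -> \bar R with
  | 0 => fun f => f 0
  | n'.+1 => fun f =>
      (\int[@lebesgue_measure R]_(x in setT) iint (fun y => f (cons_rv x y)))%E
  end.

Definition sqnorm (n : nat) (x : 'rV[R]_n) : R := \sum_(i < n) x ord0 i ^+ 2.

Definition V (n : nat) (m D : R) (x : 'rV[R]_n) : R :=
  powR (D + (1 - m) / (2 * m) * sqnorm x) (- (1 - m)^-1).

Definition mstar (d : nat) : R := (d%:R - 4) / (d%:R - 2).

Definition iter_D (n : nat) (l : seq 'rV[R]_n) (f : 'rV[R]_n -> R) : 'rV[R]_n -> R :=
  foldr (fun v g => 'D_v g) f l.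

Definition smooth (n : nat) (f : 'rV[R]_n -> R) : Prop :=
  forall (l : seq 'rV[R]_n) (x : 'rV[R]_n), differentiable (iter_D l f) x.

Definition compact_support (n : nat) (f : 'rV[R]_n -> R) : Prop :=
  exists K : set 'rV[R]_n, compact K /\ forall x, ~ K x -> f x = 0.

Definition Cc_infty (n : nat) (f : 'rV[R]_n -> R) : Prop :=
  smooth f /\ compact_support f.

Definition sqgrad (n : nat) (g : 'rV[R]_n -> R) (x : 'rV[R]_n) : R :=
  \sum_(i < n) ('D_(delta_mx 0 i : 'rV[R]_n) g x) ^+ 2.

Definition int_mu (n : nat) (m D : R) (f : 'rV[R]_n -> R) : \bar R :=
  iint (fun x => (f x * powR (V m D x) (2 - m))%:E).

Definition int_nu (n : nat) (m D : R) (f : 'rV[R]_n -> R) : \bar R :=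
  iint (fun x => (f x * V m D x)%:E).

Definition gbar (n : nat) (m D : R) (g : 'rV[R]_n -> R) : R :=
  fine (int_mu m D g) / fine (int_mu m D (fun _ : 'rV[R]_n => 1)).

End Defs.

(* Main.v *)
(** Put W = D + k|x|^2 with k = (1-m)/(2m) and a = -1/(1-m), so that
    dnu = W^a dx and dmu = W^(a-1) dx; for d >= 3 the number A := d + 2a - 2 has
    the sign of m_* - m, and A < 0 whenever d <= 4.
    Integrating the divergence of lam h^2 W^(a-1) x and completing the square
    in grad h + lam h x / W bounds int h^2 w dx by int |grad h|^2 dnu, where
    w = W^(a-2) (lam d D + lam^2 |x|^2) for lam = A k / 2.
    If A > 0, then w is at least a multiple of W^(a-1), which is (b);
    the functions W^-s, with s decreasing to A/4, cut off at infinity show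
    that the constant is optimal.
    If A < 0, then w is at least a multiple of W^(a-1) only outside a cube of
    side of order sqrt D. Inside the cube the Poincare inequality takes over,
    and scaling in D makes the resulting constant independent of D. The mean
    of g over mu is then at least as good as the constant given by the cube.
    R^n carries the product measure [rvm n], for which the iterated integral
    is a Lebesgue integral on dominated functions. *)

Require Import Defs.
From HB Require Import structures.
From mathcomp Require Import all_boot all_order all_algebra.
From mathcomp Require Import all_classical all_reals all_analysis.
From mathcomp Require Import measurable_realfun ring lra.
Import Order.TTheory GRing.Theory Num.Theory.
Import numFieldNormedType.Exports.
Local Open Scope classical_set_scope.
Local Open Scope ring_scope.

Set Implicit Arguments.
Unset Strict Implicit.
Unset Printing Implicit Defensive.

(** * Row vectors as a measure space: coordinate sigma-algebra, product measure, Tonelli and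
    Fubini *)

Section row_measurable.
Variable R : realType.

(** The choice of lam: once the square is completed, |x|^2 carries the coefficient lam A k - lam^2,
    which is largest at lam = A k / 2, where it equals lam^2. The other coefficient, lam d D, has
    the sign of A. For A > 0 both help. For A < 0 the weight is negative near the origin, as it must
    be since constants violate a Hardy inequality for a finite mu; hence the subtraction of a
    constant c and the local inequality on a cube. That subtraction destroys compact support: g - c,
    like the near-optimisers W^-s, has to be cut off where W reaches rho. All integrability
    thresholds involved are strict, so a small power W^e can be spent: the error of the cutoff is
    rho^-e times the integral of a power of W that is still integrable. Letting rho tend to infinity
    thus becomes a choice of the number y = rho^-e. Every integrand is therefore shown to be
    continuous with a decay that survives fixing coordinates. *)

Definition row_cylinders (n : nat) : set (set 'rV[R]_n) :=
  [set A | exists i (B : set (measurableTypeR R)),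
     measurable B /\ A = [set x : 'rV[R]_n | B (x ord0 i)]].

(** With the sigma-algebra generated by the coordinates, a map into row vectors is measurable as
    soon as its coordinates are, and [cons_rv] becomes an isomorphism of measurable spaces from R x
    R^n onto R^(n+1). *)
Local Notation rVm n := (g_sigma_algebraType (@row_cylinders n)).

Lemma measurable_coord n (i : 'I_n) :
  measurable_fun [set: rVm n] (fun x : rVm n => (x ord0 i : measurableTypeR R)).
Proof.
move=> _ B mB; rewrite setTI; apply: sub_sigma_algebra.
by exists i, B.
Qed.

Lemma measurable_fun_rowP d (T : measurableType d) n (f : T -> rVm n) :
  (forall i, measurable_fun setT (fun t => (f t ord0 i : measurableTypeR R))) ->
  measurable_fun setT f.
Proof.
move=> mf; apply: (@measurability _ _ _ _ setT f (@row_cylinders n)) => //.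
move=> A [B [i [C [mC ->]] <-]].
exact: mf.
Qed.

Definition head_rv n (x : 'rV[R]_n.+1) : R := x ord0 ord0.
Definition tail_rv n (x : 'rV[R]_n.+1) : 'rV[R]_n :=
  \row_(i < n) x ord0 (lift ord0 i).

Lemma cons_rv0 n t (y : 'rV[R]_n) : cons_rv t y ord0 ord0 = t.
Proof. by rewrite mxE unlift_none. Qed.

Lemma cons_rvS n t (y : 'rV[R]_n) i : cons_rv t y ord0 (lift ord0 i) = y ord0 i.
Proof. by rewrite mxE liftK. Qed.

Lemma cons_head_tail n (x : 'rV[R]_n.+1) : cons_rv (head_rv x) (tail_rv x) = x.
Proof.
apply/rowP => i; case: (unliftP ord0 i) => [j ->|->].
  by rewrite cons_rvS mxE.
by rewrite cons_rv0.
Qed.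

Lemma measurable_cons_rv n : measurable_fun [set: measurableTypeR R * rVm n]
  (fun p => cons_rv p.1 p.2 : rVm n.+1).
Proof.
apply: measurable_fun_rowP => i; case: (unliftP ord0 i) => [j ->|->].
  under eq_fun do rewrite cons_rvS.
  apply: (measurableT_comp (measurable_coord j)); exact: measurable_snd.
under eq_fun do rewrite cons_rv0.
exact: measurable_fst.
Qed.

Lemma measurable_cons_rvr n t :
  measurable_fun [set: rVm n] (fun y => cons_rv t y : rVm n.+1).
Proof.
apply: (measurable_comp measurableT _ (@measurable_cons_rv n)
  (pair1_measurable (t : measurableTypeR R))) => //.
Qed.

Lemma measurable_uncons n : measurable_fun [set: rVm n.+1]
  (fun x => (head_rv x : measurableTypeR R, tail_rv x : rVm n)).
Proof.
apply: measurable_fun_pair; first exact: measurable_coord.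
apply: measurable_fun_rowP => i.
under eq_fun do rewrite mxE.
exact: measurable_coord.
Qed.

Section cons_measure.
Variables (n : nat) (nu : {sigma_finite_measure set rVm n -> \bar R}).

Definition cons_measure : set (rVm n.+1) -> \bar R :=
  pushforward (@lebesgue_measure R \x nu)%E
    (fun p : measurableTypeR R * rVm n => cons_rv p.1 p.2 : rVm n.+1).

Let pushfwd : {measure set (rVm n.+1) -> \bar R} :=
  @measure_function_pushforward__canonical__measure_function_Measure _ _ _ _ R
    [the measure _ _ of (@lebesgue_measure R \x nu)%E] _ (@measurable_cons_rv n).

HB.instance Definition _ := isMeasure.Build _ _ _ cons_measure
  (@measure0 _ _ _ pushfwd) (@measure_ge0 _ _ _ pushfwd)
  (@measure_semi_sigma_additive _ _ _ pushfwd).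

(** Tonelli's theorem asks for sigma-finiteness of the factor, so it has to be carried along with
    the recursion that defines [rvm]. Increasing exhaustions of both factors let one index, the
    maximum, serve both. *)
Let cons_measure_sigma_finite : sigma_finite setT cons_measure.
Proof.
have /sigma_finiteP[F [TF ndF Foo]] := sigma_finiteT (@lebesgue_measure R).
have /sigma_finiteP[G [TG ndG Goo]] := sigma_finiteT nu.
pose u := (fun x : rVm n.+1 => (head_rv x : measurableTypeR R, tail_rv x : rVm n)).
exists (fun i => u @^-1` (F i `*` G i)).
  apply/seteqP; split => // x _.
  have : setT (head_rv x) by [].
  rewrite TF => -[i _ Fi].
  have : setT (tail_rv x) by [].
  rewrite TG => -[j _ Gj].
  exists (maxn i j) => //; split => /=.
    by move: Fi; apply/subsetPset/ndF; rewrite leq_maxl.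
  by move: Gj; apply/subsetPset/ndG; rewrite leq_maxr.
move=> i; have [mF Fi] := Foo i; have [mG Gi] := Goo i; split.
  rewrite -[X in measurable X]setTI; apply: measurable_uncons => //.
  exact: measurableX.
rewrite /cons_measure /pushforward (_ : _ @^-1` _ = F i `*` G i).
  rewrite product_measure1E// lte_mul_pinfty// ?ge0_fin_numE//.
by apply/seteqP; split => -[t y]; rewrite /u /= /head_rv cons_rv0;
  rewrite (_ : tail_rv _ = y)//; apply/rowP => j; rewrite mxE cons_rvS.
Qed.

HB.instance Definition _ := Measure_isSigmaFinite.Build _ _ _ cons_measure
  cons_measure_sigma_finite.

Lemma ge0_integral_cons_measure (f : rVm n.+1 -> \bar R) :
  measurable_fun [set: rVm n.+1] f -> (forall x, 0 <= f x)%E ->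
  (\int[cons_measure]_x f x =
   \int[@lebesgue_measure R]_t \int[nu]_y f (cons_rv t y))%E.
Proof.
move=> mf f0.
rewrite (ge0_integral_pushforward (@measurable_cons_rv n))//.
rewrite preimage_setT fubini_tonelli1//.
  exact: (measurable_comp measurableT _ mf (@measurable_cons_rv n)).
by move=> p; exact: f0.
Qed.

End cons_measure.

(** Mirrors the recursion of [iint]: the Dirac mass at the only point of R^0 matches its base case
    [f 0]. *)
Fixpoint rvm (n : nat) : {sigma_finite_measure set rVm n -> \bar R} :=
  match n return {sigma_finite_measure set rVm n -> \bar R} with
  | 0 => \d_(0 : rVm 0)
  | n'.+1 => cons_measure (rvm n')
  end.


(** Both orders serve: [iint] has the first coordinate outermost, while a derivative in that
    coordinate has to be integrated innermost. *)
Lemma integral_rvmS n (f : rVm n.+1 -> \bar R) :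
  (rvm n.+1).-integrable setT f ->
  (\int[rvm n.+1]_x f x =
   \int[@lebesgue_measure R]_t \int[rvm n]_y f (cons_rv t y))%E /\
  (\int[rvm n.+1]_x f x =
   \int[rvm n]_y \int[@lebesgue_measure R]_t f (cons_rv t y))%E.
Proof.
move=> intf.
have mf : measurable_fun [set: rVm n.+1] f by case/integrableP: intf.
pose c := (fun p : measurableTypeR R * rVm n => cons_rv p.1 p.2 : rVm n.+1).
have mfc : measurable_fun setT (f \o c).
  exact: (measurable_comp measurableT _ mf (@measurable_cons_rv n)).
have intfc : (@lebesgue_measure R \x rvm n)%E.-integrable setT (f \o c).
  apply/integrableP; split => //.
  case/integrableP : intf => _.
  rewrite (ge0_integral_pushforward (@measurable_cons_rv n))//.
  exact: measurableT_comp.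
have E : (\int[rvm n.+1]_x f x =
    \int[@lebesgue_measure R \x rvm n]_p (f \o c) p)%E.
  by rewrite (integral_pushforward (@measurable_cons_rv n)).
by split; rewrite E; [rewrite -integral12_prod_meas1|rewrite -integral21_prod_meas1].
Qed.

Lemma ge0_integral_rvmS n (f : rVm n.+1 -> \bar R) :
  measurable_fun [set: rVm n.+1] f -> (forall x, 0 <= f x)%E ->
  (\int[rvm n.+1]_x f x =
   \int[@lebesgue_measure R]_t \int[rvm n]_y f (cons_rv t y))%E.
Proof. exact: ge0_integral_cons_measure. Qed.

Lemma measurable_integral_slice n (f : rVm n.+1 -> \bar R) :
  measurable_fun [set: rVm n.+1] f -> (forall x, 0 <= f x)%E ->
  measurable_fun [set: measurableTypeR R]
    (fun t : measurableTypeR R => \int[rvm n]_y f (cons_rv t y))%E.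
Proof.
move=> mf f0.
apply: (@measurable_fun_fubini_tonelli_F _ _ _ _ _ (rvm n)
  (fun p : measurableTypeR R * rVm n => f (cons_rv p.1 p.2))) => [|p].
  exact: (measurable_comp measurableT _ mf (@measurable_cons_rv n)).
exact: f0.
Qed.

Lemma floor_approx (x : R) (k : nat) :
  `|x - (Num.floor (k.+1%:R * x))%:~R / k.+1%:R| <= k.+1%:R^-1.
Proof.
set y := k.+1%:R * x.
have k0 : 0 < k.+1%:R :> R by rewrite ltr0n.
have -> : x - (Num.floor y)%:~R / k.+1%:R = (y - (Num.floor y)%:~R) / k.+1%:R.
  by rewrite /y; field; rewrite lt0r_neq0.
rewrite normrM [X in _ * X]ger0_norm; last by rewrite invr_ge0 ltW.
apply: ler_piMl; first by rewrite invr_ge0 ltW.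
have := floor_itv y.
rewrite ler_norml intrD => /andP[h1 h2].
by apply/andP; split; lra.
Qed.

(** Links the norm topology to the coordinate sigma-algebra. Rounding each coordinate down to the
    grid of mesh 1/(k+1) gives functions with countably many values, each taken on a union of
    products of half-open intervals; by continuity they converge pointwise to [f]. *)
Lemma continuous_measurable_rv n (f : 'rV[R]_n -> R) : continuous f ->
  measurable_fun [set: rVm n] (f : rVm n -> R).
Proof.
move=> cf.
pose q (k : nat) (z : 'rV[int]_n) : 'rV[R]_n :=
  \row_i ((z ord0 i)%:~R / k.+1%:R).
pose fl (k : nat) (x : 'rV[R]_n) : 'rV[int]_n :=
  \row_i Num.floor (k.+1%:R * x ord0 i).
apply: (@measurable_fun_cvg _ (rVm n) R _ (fun k x => f (q k (fl k x)))) => //.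
  move=> k _ /= B mB; rewrite setTI.
  have -> : (fun x => f (q k (fl k x))) @^-1` B =
      \bigcup_(z in [set z | B (f (q k z))]) [set x | fl k x = z].
    apply/seteqP; split => [x /= Bx|x [z /= Bz xz]]; first by exists (fl k x).
    by rewrite /preimage /= xz.
  (* The union over integer vectors is reindexed by natural numbers; codes that decode to nothing
     contribute the empty set. *)
  pose F (i : nat) : set (rVm n) := if unpickle i is Some z then
    [set x | fl k x = z /\ B (f (q k z))] else set0.
  have -> : \bigcup_(z in [set z | B (f (q k z))]) [set x | fl k x = z] =
      \bigcup_i F i.
    apply/seteqP; split => [x [z /= Bz xz]|x [i _]].
      by exists (pickle z) => //; rewrite /F pickleK.
    by rewrite /F; case: unpickle => // z [xz Bz]; exists z.
  apply: bigcupT_measurable => i; rewrite /F; case: unpickle => // z.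
  have [Bz|nBz] := pselect (B (f (q k z))); last first.
    by rewrite (_ : [set x | _] = set0)//; apply/seteqP; split => // x [].
  have -> : [set x | fl k x = z /\ B (f (q k z))] = \bigcap_(j in [set: 'I_n])
      ((fun x : rVm n => k.+1%:R * x ord0 j) @^-1`
         `[(z ord0 j)%:~R, (z ord0 j + 1)%:~R[).
    apply/seteqP; split => [x [<- _] j _|x xz].
      by rewrite /= in_itv /= mxE; exact: floor_itv.
    split => //; apply/rowP => j; rewrite mxE.
    by apply: floor_def; have := xz j Logic.I; rewrite /= in_itv.
  apply: fin_bigcap_measurable => // j _; rewrite -[X in measurable X]setTI.
  have : measurable_fun [set: rVm n] (fun x : rVm n => k.+1%:R * x ord0 j).
    by apply: measurable_funM => //; exact: measurable_coord.
  by apply.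
move=> x _.
suff h : q k (fl k x) @[k --> \oo] --> (x : 'rV[R]_n).
  exact: (cvg_comp _ _ h (cf x)).
apply/cvgrPdist_le => e e0.
near=> k; rewrite /Num.norm /= mx_normrE.
apply/bigmax_leP; split => [|[i j] _ /=]; first exact: ltW.
rewrite (ord1 i) !mxE; apply: le_trans (floor_approx _ _) _.
apply/ltW; near: k; exact: (near_infty_natSinv_lt (PosNum e0)).
Unshelve. all: by end_near.
Qed.
End row_measurable.
Notation rVm R n := (g_sigma_algebraType (@row_cylinders R n)).
Arguments rvm {R} n.

(** * Decay in powers of 1 + |x|^2, and the iterated integral as a Lebesgue integral *)

Section bracket.
Variable R : realType.
Local Notation mu := (@lebesgue_measure R).

Lemma rv_norm_leP n (x : 'rV[R]_n) (e : R) : 0 <= e ->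
  (`|x| <= e) <-> (forall i, `|x ord0 i| <= e).
Proof.
move=> e0; rewrite {1}/Num.norm /= mx_normrE; split => [|h].
  by move=> /bigmax_leP[_ +] i => /(_ (ord0, i) isT).
by apply/bigmax_leP; split => // -[i j] _ /=; rewrite (ord1 i).
Qed.

Lemma cons_rvB n s t (y z : 'rV[R]_n) :
  cons_rv s y - cons_rv t z = cons_rv (s - t) (y - z).
Proof.
apply/rowP => i; rewrite !mxE; case: unliftP => // j _; by rewrite !mxE.
Qed.

Lemma cons_rvD n s t (y z : 'rV[R]_n) :
  cons_rv s y + cons_rv t z = cons_rv (s + t) (y + z).
Proof.
apply/rowP => i; rewrite !mxE; case: unliftP => // j _; by rewrite !mxE.
Qed.

Lemma cons_rvZ n c t (y : 'rV[R]_n) : c *: cons_rv t y = cons_rv (c * t) (c *: y).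
Proof.
apply/rowP => i; rewrite !mxE; case: unliftP => // j _; by rewrite !mxE.
Qed.

Lemma norm_cons_rv n t (y : 'rV[R]_n) : `|cons_rv t y| <= Num.max `|t| `|y|.
Proof.
apply/rv_norm_leP; first by rewrite le_max normr_ge0.
move=> i; case: (unliftP ord0 i) => [j ->|->].
  by rewrite cons_rvS le_max; apply/orP; right; apply: (rv_norm_leP _ _).1.
by rewrite cons_rv0 le_max lexx.
Qed.

Lemma continuous_cons_rv n (y : 'rV[R]_n) : continuous (fun t => cons_rv t y).
Proof.
move=> t; apply/cvgrPdist_le => e e0; near=> s.
rewrite cons_rvB subrr (le_trans (norm_cons_rv _ _))// normr0 ge_max (ltW e0) andbT.
near: s; by apply: cvgr_dist_le e0; exact: cvg_id.
Unshelve. all: by end_near.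
Qed.

Lemma continuous_cons_rvr n t : continuous (fun y : 'rV[R]_n => cons_rv t y).
Proof.
move=> y; apply/(@cvgrPdist_le _ _ _ (nbhs y)) => e e0; near=> z.
rewrite cons_rvB subrr (le_trans (norm_cons_rv _ _))// normr0 ge_max (ltW e0) /=.
near: z; by apply: cvgr_dist_le e0; exact: cvg_id.
Unshelve. all: by end_near.
Qed.

Lemma continuous_slice0 n (f : 'rV[R]_n.+1 -> R) y :
  continuous f -> continuous (fun t : R => f (cons_rv t y)).
Proof.
move=> cf t; apply: (@continuous_comp R 'rV[R]_n.+1 R (fun t => cons_rv t y) f t).
  exact: continuous_cons_rv.
exact: cf.
Qed.

Lemma continuous_sliceS n (f : 'rV[R]_n.+1 -> R) t :
  continuous f -> continuous (fun y : 'rV[R]_n => f (cons_rv t y)).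
Proof.
move=> cf y.
apply: (@continuous_comp 'rV[R]_n 'rV[R]_n.+1 R (fun y => cons_rv t y) f y).
  exact: continuous_cons_rvr.
exact: cf.
Qed.

Lemma sqnorm_cons n t (y : 'rV[R]_n) : sqnorm (cons_rv t y) = t ^+ 2 + sqnorm y.
Proof.
rewrite /sqnorm big_ord_recl cons_rv0; congr (_ + _).
by apply: eq_bigr => i _; rewrite cons_rvS.
Qed.

Lemma sqnorm_ge0 n (x : 'rV[R]_n) : 0 <= sqnorm x.
Proof. by apply: sumr_ge0 => i _; exact: sqr_ge0. Qed.

Lemma coord_sqr_le n (x : 'rV[R]_n) i : x ord0 i ^+ 2 <= sqnorm x.
Proof.
rewrite /sqnorm (bigD1 i)//= lerDl; apply: sumr_ge0 => j _; exact: sqr_ge0.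
Qed.

Lemma continuous_sqnorm n : continuous (@sqnorm R n).
Proof.
move=> x; apply: (@cvg_big _ _ _ _ _ _ _ (nbhs x)); first exact: add_continuous.
by move=> i _; apply: cvgM; exact: coord_continuous.
Qed.

Definition bracket n (x : 'rV[R]_n) : R := 1 + sqnorm x.

Lemma bracket_ge1 n (x : 'rV[R]_n) : 1 <= bracket x.
Proof. by rewrite lerDl sqnorm_ge0. Qed.

Lemma bracket_gt0 n (x : 'rV[R]_n) : 0 < bracket x.
Proof. exact: (lt_le_trans ltr01 (bracket_ge1 x)). Qed.

Lemma gt0_powRD (x r s : R) : 0 < x -> x `^ (r + s) = x `^ r * x `^ s.
Proof. by move=> x0; rewrite powRD//; apply/implyP => _; rewrite gt_eqF. Qed.

Lemma ler_powRN (p x y : R) : 0 <= p -> 0 < x -> x <= y -> y `^ (- p) <= x `^ (- p).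
Proof.
move=> p0 x0 xy; have y0 := lt_le_trans x0 xy.
rewrite !powRN lef_pV2 ?posrE ?powR_gt0//.
by apply: ge0_ler_powR => //; rewrite nnegrE ltW.
Qed.

Lemma continuous_powR_at (p x : R) : 0 < x -> {for x, continuous (@powR R ^~ p)}.
Proof.
move=> x0; have [d _] := is_derive1_powR p x0.
by apply: differentiable_continuous; apply/derivable1_diffP.
Qed.

Lemma continuous_powR_comp (T : topologicalType) (f : T -> R) (p : R) :
  (forall x, 0 < f x) -> continuous f -> continuous (fun x => f x `^ p).
Proof.
move=> f0 cf x.
apply: (@cvg_comp _ _ _ f (fun y => y `^ p) _ (nbhs (f x)) _ (cf x)).
exact: continuous_powR_at.
Qed.

(** From (1 + x)^2 <= 2 (1 + x^2): it trades the integrand for one with an explicit primitive. *)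
Lemma bracket1_le (q x : R) : 0 <= q -> 0 <= x ->
  (1 + x ^+ 2) `^ (- q) <= 2 `^ q * (1 + x) `^ (- (2 * q)).
Proof.
move=> q0 x0; have x1 : 0 < 1 + x by lra.
have -> : 2 `^ q * (1 + x) `^ (- (2 * q)) = (2^-1 * (1 + x) ^+ 2) `^ (- q).
  rewrite powRM ?invr_ge0 ?sqr_ge0//; congr (_ * _).
    by rewrite -powR_inv1// -powRrM mulrNN mul1r.
  by rewrite -powR_mulrn ?(ltW x1)// -powRrM mulrN.
apply: ler_powRN => //; first by rewrite mulr_gt0 ?invr_gt0 ?exprn_gt0.
by have := sqr_ge0 (1 - x); nra.
Qed.

Lemma continuous_bracket1 (q : R) : continuous (fun t : R => (1 + t ^+ 2) `^ q).
Proof.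
apply: continuous_powR_comp => t; first by rewrite ltr_pwDl// sqr_ge0.
by apply: cvgD; [exact: cvg_cst|apply: cvgM; exact: cvg_id].
Qed.

Lemma measurable_bracket1 (q : R) : measurable_fun [set: measurableTypeR R]
  (fun t : R => ((1 + t ^+ 2) `^ q)%:E).
Proof.
by apply/measurable_EFinP; apply: continuous_measurable_fun; exact: continuous_bracket1.
Qed.

Lemma integral_bracket1_lty (q : R) : 2^-1 < q ->
  (\int[mu]_t ((1 + t ^+ 2) `^ (- q))%:E < +oo)%E.
Proof.
move=> q2; have q0 : 0 < q by lra.
have cf := @continuous_bracket1 (- q).
rewrite ge0_symfun_integralT//; last first.
- by move=> x /=; rewrite sqrrN.
- by move=> x; exact: powR_ge0.
rewrite -set_itvcy lte_mul_pinfty//.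
(* The primitive of (1 + x)^(-2q); it vanishes at infinity because q > 1/2. *)
pose F (x : R) := (1 + x) `^ (1 - 2 * q) / (1 - 2 * q).
have q12 : 1 - 2 * q < 0 by lra.
have dF (x : R) : 0 <= x -> is_derive x 1 F ((1 + x) `^ (- (2 * q))).
  move=> x0; have x1 : 0 < 1 + x by lra.
  have dg : is_derive x (1 : R) (fun y : R => 1 + y) (0 + 1).
    by apply: is_deriveD.
  have h := @is_derive1_comp R (@powR R ^~ (1 - 2 * q)) _ x _ _
    (is_derive1_powR (1 - 2 * q) x1) dg.
  have -> : F = ((1 - 2 * q)^-1) *: ((@powR R ^~ (1 - 2 * q)) \o (fun y : R => 1 + y)).
    by apply/funext => y; rewrite /F /= mulrC.
  apply: is_derive_eq.
  rewrite /GRing.scale /= add0r mulr1 (_ : 1 - 2 * q - 1 = - (2 * q)); last by ring.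
  by field; rewrite lt_eqF.
have cF (x : R) : 0 <= x -> {for x, continuous F}.
  by move=> x0; have [d _] := dF x x0;
    apply: differentiable_continuous; apply/derivable1_diffP.
have cf2 : {in `[0%R, +oo[%classic, continuous (fun x : R => (1 + x) `^ (- (2 * q)))}.
  move=> x; rewrite inE /= in_itv /= andbT => x0; have x1 : 0 < 1 + x by lra.
  apply: (@continuous_comp _ _ _ (fun y : R => 1 + y) (@powR R ^~ (- (2 * q)))).
    by apply: cvgD; [exact: cvg_cst|exact: cvg_id].
  exact: continuous_powR_at.
have mf2 : @measurable_fun _ _ (measurableTypeR R) (measurableTypeR R)
    [set` `[0%R, +oo[] (fun x : R => (1 + x) `^ (- (2 * q))).
  apply: subspace_continuous_measurable_fun => //.
  exact: continuous_in_subspaceT.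
have Foo : F x @[x --> +oo] --> (0 : R).
  rewrite [X in _ --> X](_ : _ = 0 * (1 - 2 * q)^-1); last by rewrite mul0r.
  apply: cvgM; last exact: cvg_cst.
  apply/cvgr0Pnorm_le => e e0; near=> x.
  rewrite ger0_norm ?powR_ge0// (_ : 1 - 2 * q = - (2 * q - 1)); last by ring.
  apply: (@le_trans _ _ ((e `^ (- (2 * q - 1)^-1)) `^ (- (2 * q - 1)))).
    apply: ler_powRN; [lra|exact: powR_gt0|].
    have hx : e `^ (- (2 * q - 1)^-1) <= x.
      by near: x; apply: nbhs_pinfty_ge; exact: num_real.
    by rewrite (le_trans hx)// lerDr.
  rewrite -powRrM mulrNN mulVf ?powRr1 ?(ltW e0)//.
  by rewrite subr_eq0; apply/eqP; lra.
have FE : (\int[mu]_(x in `[0%R, +oo[) ((1 + x) `^ (- (2 * q)))%:E = 0%:E - (F 0)%:E)%E.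
  apply: ge0_continuous_FTC2y => //.
  - by move=> x _; exact: powR_ge0.
  - exact: continuous_in_subspaceT.
  - by move=> x x0; have [] := dF x (ltW x0).
  - by apply: cvg_at_right_filter; exact: cF.
  - move=> x; rewrite in_itv /= andbT => x0.
    by rewrite derive1E; have [_ ->] := dF x (ltW x0).
apply: (@le_lt_trans _ _ (\int[mu]_(x in `[0%R, +oo[)
    ((2 `^ q)%:E * ((1 + x) `^ (- (2 * q)))%:E))%E).
  apply: ge0_le_integral => //=.
  - by move=> x _; rewrite lee_fin powR_ge0.
  - by apply/measurable_EFinP/measurable_funTS; exact: continuous_measurable_fun.
  - by apply: measurable_funeM; exact/measurable_EFinP.
  move=> x; rewrite in_itv /= andbT => x0.
  by rewrite -EFinM lee_fin bracket1_le// ltW.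
rewrite ge0_integralZl//; last 2 first.
- exact/measurable_EFinP.
- by move=> x _; rewrite lee_fin powR_ge0.
by rewrite FE lte_mul_pinfty// ?lee_fin ?powR_ge0// ltry.
Unshelve. all: by end_near.
Qed.

Lemma continuous_bracket n : continuous (@bracket n).
Proof.
move=> x; apply: (@cvgD _ _ _ (nbhs x)); first exact: cvg_cst.
exact: continuous_sqnorm.
Qed.

Lemma continuous_bracket_powR n p : continuous (fun x : 'rV[R]_n => bracket x `^ p).
Proof.
by apply: continuous_powR_comp; [exact: bracket_gt0|exact: continuous_bracket].
Qed.

Lemma measurable_EFin_rv n (f : 'rV[R]_n -> R) : continuous f ->
  measurable_fun [set: rVm R n] (fun x => (f x)%:E).
Proof. by move=> cf; apply/measurable_EFinP; exact: continuous_measurable_rv. Qed.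

Lemma integral_rvm0 (f : 'rV[R]_0 -> R) : continuous f ->
  (\int[rvm 0]_x (f x)%:E = (f 0)%:E)%E.
Proof.
move=> cf; rewrite /rvm integral_dirac//; first by rewrite diracT mul1e.
exact: measurable_EFin_rv.
Qed.

(** Since 1 + t^2 + |y|^2 dominates both 1 + t^2 and 1 + |y|^2, its power -p is at most a product of
    powers of these two, and the exponent can be shared between the coordinates. *)
Lemma integral_bracket_lty n p : n%:R / 2 < p ->
  (\int[rvm n]_x (bracket (x : 'rV[R]_n) `^ (- p))%:E < +oo)%E.
Proof.
elim: n p => [|n IH] p np.
  by rewrite integral_rvm0 ?ltry//; exact: continuous_bracket_powR.
(* Half of the slack p - (n+1)/2 goes to the first coordinate, so q1 > 1/2, and the other half
   leaves p - q1 > n/2. *)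
pose q1 : R := 2^-1 + (p - n.+1%:R / 2) / 2.
have q1p : 2^-1 < q1 by rewrite /q1 ltrDl divr_gt0// subr_gt0.
have p1p : n%:R / 2 < p - q1 by rewrite /q1; move: np; rewrite -natr1; lra.
have n0 : 0 <= n%:R / 2 :> R by rewrite divr_ge0.
have mB m r : measurable_fun [set: rVm R m] (fun x => (bracket x `^ r)%:E).
  by apply: measurable_EFin_rv; exact: continuous_bracket_powR.
have pB m r (x : 'rV[R]_m) : (0 <= (bracket x `^ r)%:E)%E.
  by rewrite lee_fin powR_ge0.
rewrite ge0_integral_rvmS; [|exact: mB|by move=> x; exact: pB].
apply: (@le_lt_trans _ _ (\int[mu]_t (((1 + t ^+ 2) `^ (- q1))%:E *
   \int[rvm n]_y (bracket (y : 'rV[R]_n) `^ (- (p - q1)))%:E))%E).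
  have m1 := measurable_bracket1 (- q1).
  apply: ge0_le_integral; [exact: measurableT|..].
  - by move=> t _; apply: integral_ge0 => y _; exact: pB.
  - apply: (@measurable_integral_slice _ _ (fun x => (bracket x `^ (- p))%:E)).
      exact: mB.
    by move=> x; exact: pB.
  - by apply: emeasurable_funM => //; exact: measurable_cst.
  move=> t _; rewrite -ge0_integralZl; [|exact: measurableT|exact: mB| |]; last 2 first.
  - by move=> y _; exact: pB.
  - by rewrite lee_fin powR_ge0.
  apply: ge0_le_integral; [exact: measurableT|by move=> y _; exact: pB|..].
  - exact: (measurable_comp measurableT _ (mB n.+1 (- p)) (measurable_cons_rvr t)).
  - by apply: measurable_funeM; exact: mB.
  move=> y _; rewrite -EFinM lee_fin.
  have -> : - p = - q1 - (p - q1) by ring.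
  have t0 := sqr_ge0 t; have y0 := sqnorm_ge0 y.
  rewrite gt0_powRD ?bracket_gt0//.
  apply: ler_pM; rewrite ?powR_ge0//; apply: ler_powRN;
    rewrite ?bracket_gt0 ?/bracket ?sqnorm_cons//; lra.
rewrite ge0_integralZr; [|exact: measurableT|exact: measurable_bracket1| |]; last 2 first.
- by move=> t _; rewrite lee_fin powR_ge0.
- by apply: integral_ge0 => y _; exact: pB.
apply: lte_mul_pinfty; last exact: IH.
  by apply: integral_ge0 => t _; rewrite lee_fin powR_ge0.
rewrite ge0_fin_numE; first exact: integral_bracket1_lty.
by apply: integral_ge0 => t _; rewrite lee_fin powR_ge0.
Qed.

(** Integrability alone would say nothing about an individual slice. This pointwise bound passes to
    every slice with the same exponent, so the induction that identifies [iint] with the integral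
    goes through; n/2 is the threshold of [integral_bracket_lty]. *)
Definition dominated n (f : 'rV[R]_n -> R) := continuous f /\
  exists M p : R, n%:R / 2 < p /\ forall x, `|f x| <= M * bracket x `^ (- p).

Lemma dominated_integrable n (f : 'rV[R]_n -> R) : dominated f ->
  (rvm n).-integrable setT (EFin \o (f : rVm R n -> R)).
Proof.
move=> [cf [M [p [np fM]]]].
apply: (@le_integrable _ _ _ _ _ _ _ (fun x : rVm R n => (M * bracket x `^ (- p))%:E)) => //.
- exact: measurable_EFin_rv.
- move=> x _; rewrite /= lee_fin (le_trans (fM x))//; exact: ler_norm.
under eq_fun do rewrite EFinM.
apply: integrableZl => //; apply/integrableP; split.
  by apply: measurable_EFin_rv; exact: continuous_bracket_powR.
under eq_integral do rewrite gee0_abs ?lee_fin ?powR_ge0//.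
exact: integral_bracket_lty.
Qed.

Lemma dominated_slice n (f : 'rV[R]_n.+1 -> R) t : dominated f ->
  dominated (fun y => f (cons_rv t y)).
Proof.
move=> [cf [M [p [np fM]]]]; split.
  exact: continuous_sliceS.
have np' : n%:R / 2 < p by move: np; rewrite -natr1; lra.
have n0 : 0 <= n%:R / 2 :> R by rewrite divr_ge0.
exists M, p; split => // y; rewrite (le_trans (fM _))//.
have M0 : 0 <= M.
  rewrite -(@pmulr_lge0 _ (bracket (cons_rv t y) `^ (- p))) ?powR_gt0 ?bracket_gt0//.
  exact: le_trans (normr_ge0 _) (fM _).
apply: ler_wpM2l => //; apply: ler_powRN; [lra|exact: bracket_gt0|].
by rewrite /bracket sqnorm_cons lerD2l lerDr sqr_ge0.
Qed.

Lemma iintE n (f : 'rV[R]_n -> R) : dominated f ->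
  (iint (fun x => (f x)%:E) = \int[rvm n]_x (f x)%:E)%E.
Proof.
elim: n f => [|n IH] f df /=; first by rewrite integral_rvm0//; case: df.
have [-> _] := integral_rvmS (dominated_integrable df).
apply: eq_integral => t _; rewrite IH//; exact: dominated_slice.
Qed.

Lemma iint_Rintegral n (f : 'rV[R]_n -> R) : dominated f ->
  iint (fun x => (f x)%:E) = (\int[rvm n]_x f x)%:E.
Proof.
move=> df; rewrite iintE// /Rintegral fineK//.
exact: (integrable_fin_num _ (dominated_integrable df)).
Qed.

End bracket.

(** * Partial derivatives of functions with bounded support have integral zero *)

Section divergence.
Variable R : realType.
Local Notation mu := (@lebesgue_measure R).
Local Notation dx i := (delta_mx 0 i).

Lemma delta_cons0 n : delta_mx 0 ord0 = cons_rv 1 0 :> 'rV[R]_n.+1.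
Proof.
apply/rowP => i; case: (unliftP ord0 i) => [j ->|->].
  by rewrite cons_rvS !mxE.
by rewrite cons_rv0 mxE.
Qed.

Lemma delta_consS n (i : 'I_n) :
  delta_mx 0 (lift ord0 i) = cons_rv 0 (delta_mx 0 i) :> 'rV[R]_n.+1.
Proof.
apply/rowP => j; case: (unliftP ord0 j) => [k ->|->].
  by rewrite cons_rvS !mxE (inj_eq lift_inj).
by rewrite cons_rv0 !mxE.
Qed.

Lemma quotient_cons0 n (f : 'rV[R]_n.+1 -> R) t y :
  (fun h : R => h^-1 *: (f (h *: dx ord0 + cons_rv t y) - f (cons_rv t y))) =
  (fun h : R => h^-1 *: (f (cons_rv (h *: 1 + t) y) - f (cons_rv t y))).
Proof.
apply/funext => h; rewrite delta_cons0 cons_rvZ cons_rvD scaler0 add0r.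
by rewrite /GRing.scale /= !mulr1.
Qed.

Lemma quotient_consS n (f : 'rV[R]_n.+1 -> R) i t y :
  (fun h : R => h^-1 *: (f (h *: dx (lift ord0 i) + cons_rv t y) - f (cons_rv t y))) =
  (fun h : R => h^-1 *: (f (cons_rv t (h *: dx i + y)) - f (cons_rv t y))).
Proof.
by apply/funext => h; rewrite delta_consS cons_rvZ cons_rvD mulr0 add0r.
Qed.

Lemma derive_cons0 n (f : 'rV[R]_n.+1 -> R) t y :
  'D_(dx ord0) f (cons_rv t y) = 'D_1 (fun s : R => f (cons_rv s y)) t.
Proof. by rewrite /derive quotient_cons0. Qed.

Lemma derivable_cons0 n (f : 'rV[R]_n.+1 -> R) t y :
  derivable f (cons_rv t y) (dx ord0) ->
  derivable (fun s : R => f (cons_rv s y)) t 1.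
Proof. by rewrite /derivable quotient_cons0. Qed.

Lemma derive_consS n (f : 'rV[R]_n.+1 -> R) i t y :
  'D_(dx (lift ord0 i)) f (cons_rv t y) = 'D_(dx i) (fun z => f (cons_rv t z)) y.
Proof. by rewrite /derive quotient_consS. Qed.

Lemma derivable_consS n (f : 'rV[R]_n.+1 -> R) i t y :
  derivable f (cons_rv t y) (dx (lift ord0 i)) ->
  derivable (fun z => f (cons_rv t z)) y (dx i).
Proof. by rewrite /derivable quotient_consS. Qed.

(** Equivalent to compact support, but a radius passes more directly to slices, derivatives and
    products than a compact set does. *)
Definition bounded_support n (f : 'rV[R]_n -> R) :=
  exists B : R, forall x, B < `|x| -> f x = 0.

Lemma bounded_supportP n (f : 'rV[R]_n -> R) :
  bounded_support f <-> compact_support f.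
Proof.
split => [[B fB]|[K [cK fK]]].
  exists [set x | forall i, `[- B, B]%classic (x ord0 i)]; split.
    by apply: (@rV_compact _ _ (fun=> `[- B, B]%classic)) => i; exact: segment_compact.
  move=> x nK; apply: fB; rewrite ltNge; apply/negP => xB; apply: nK => i /=.
  have B0 : 0 <= B by rewrite (le_trans _ xB).
  by rewrite in_itv /= -ler_norml; apply: (rv_norm_leP _ B0).1.
have [M [Mr KM]] := compact_bounded cK.
exists (M + 1) => x Mx; apply: fK => Kx.
have := KM (M + 1); rewrite ltrDl => /(_ ltr01 x Kx) /=.
by rewrite leNgt Mx.
Qed.

Lemma near_normr_gt n (x : 'rV[R]_n) (B : R) : B < `|x| ->
  \forall z \near x, B < `|z|.
Proof.
move=> Bx.
exact: (@cvgr_gt R _ (nbhs x) _ (fun z : 'rV[R]_n => `|z|) _ (@norm_continuous R _ x) B Bx).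
Qed.

Lemma bounded_support_derive n (f : 'rV[R]_n -> R) v :
  bounded_support f -> bounded_support ('D_v f).
Proof.
move=> [B fB]; exists B => x Bx.
have [->|v0] := eqVneq v 0; first by rewrite derive0.
rewrite (@near_eq_derive _ _ _ f (cst 0)) ?derive_cst//.
by near=> z; apply: fB; near: z; exact: near_normr_gt.
Unshelve. all: by end_near.
Qed.

Lemma bounded_support_norm_le n (f : 'rV[R]_n -> R) : continuous f ->
  bounded_support f -> exists M, forall x, `|f x| <= M.
Proof.
move=> cf [B fB].
pose A := [set x : 'rV[R]_n | forall i, `[- B, B]%classic (x ord0 i)].
have cA : compact A.
  by apply: (@rV_compact _ _ (fun=> `[- B, B]%classic)) => i; exact: segment_compact.
have cfA : compact (f @` A).
  by apply: continuous_compact => //; exact: continuous_subspaceT.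
have [M [Mr KM]] := compact_bounded cfA.
exists (Num.max (M + 1) 0) => x.
have [Bx|xB] := ltP B `|x|; first by rewrite fB// normr0 le_max lexx orbT.
rewrite le_max; apply/orP; left; apply: KM; first by rewrite ltrDl.
exists x => // i /=.
have B0 : 0 <= B by rewrite (le_trans _ xB).
by rewrite in_itv /= -ler_norml; apply: (rv_norm_leP _ B0).1.
Qed.

Lemma bounded_support_dominated n (f : 'rV[R]_n -> R) : continuous f ->
  bounded_support f -> dominated f.
Proof.
move=> cf sf; split => //; have [M fM] := bounded_support_norm_le cf sf.
have [B fB] := sf; pose p : R := n%:R / 2 + 1.
have p0 : 0 <= p by rewrite addr_ge0// divr_ge0.
(* The norm is the maximum norm, so on the support |x|^2 is at most n B^2; any exponent above n/2
   would do. *)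
exists (M * (1 + n%:R * B ^+ 2) `^ p), p; split; first by rewrite ltrDl.
move=> x; have M0 : 0 <= M := le_trans (normr_ge0 _) (fM x).
have [Bx|xB] := ltP B `|x|.
  by rewrite fB// normr0 !mulr_ge0 ?powR_ge0.
rewrite (le_trans (fM x))// -mulrA ler_peMr// powRN ler_pdivlMr ?powR_gt0 ?bracket_gt0//.
rewrite mul1r; apply: ge0_ler_powR => //; rewrite ?nnegrE ?(ltW (bracket_gt0 _))//.
  by rewrite addr_ge0// mulr_ge0// sqr_ge0.
rewrite lerD2l /sqnorm (@le_trans _ _ (\sum_(i < n) B ^+ 2))//; last first.
  by rewrite sumr_const card_ord mulr_natl.
have B0 : 0 <= B by rewrite (le_trans _ xB).
apply: ler_sum => i _; rewrite -real_normK ?num_real//.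
by apply: lerXn2r; rewrite ?nnegrE//; apply: (rv_norm_leP _ B0).1.
Qed.

Lemma integral_derive1_eq0 (f : R -> R) (B : R) : (forall t, derivable f t 1) ->
  continuous ('D_1 f) -> (forall t, B < `|t| -> f t = 0) ->
  (\int[mu]_t ('D_1 f t)%:E = 0)%E.
Proof.
(* C is positive even if B is not, and exceeds B strictly, so that f vanishes at both ends of
   [-C, C]. *)
move=> df cf fB; pose C := Num.max B 0 + 1.
have C0 : 0 < C by rewrite ltr_wpDl// le_max lexx orbT.
have BC : B < C by rewrite ltr_pwDr// le_max lexx.
have -> : (\int[mu]_t ('D_1 f t)%:E = \int[mu]_(t in `[(- C)%R, C]) ('D_1 f t)%:E)%E.
  rewrite [RHS]integral_mkcond; apply: eq_integral => t _.
  rewrite patchE; case: ifPn => // /negP tC.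
  congr (_%:E); rewrite (@near_eq_derive _ _ _ f (cst 0)) ?derive_cst//.
  have Bt : B < `|t|.
    rewrite (lt_trans BC)// ltNge; apply/negP; rewrite ler_norml => tC'; apply: tC.
    by rewrite inE /= in_itv.
  near=> s; apply: fB; near: s.
  by apply: cvgr_gt Bt; exact: norm_continuous.
have CC : - C < C by lra.
rewrite (@continuous_FTC2 _ _ f)//.
- by rewrite !fB ?subee// ?normrN gtr0_norm.
- exact: continuous_subspaceT.
- split.
  + by move=> x _; exact: df.
  + apply: cvg_at_right_filter; apply: differentiable_continuous; exact/derivable1_diffP.
  + apply: cvg_at_left_filter; apply: differentiable_continuous; exact/derivable1_diffP.
- by move=> x _; rewrite derive1E.
Unshelve. all: by end_near.
Qed.

(** For a later coordinate, integrate the slices first and use induction; for the first coordinate,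
    swap the order so that the one-dimensional case applies inside. *)
Lemma integral_derive_eq0 n (f : 'rV[R]_n -> R) (i : 'I_n) :
  (forall x, derivable f x (dx i)) -> continuous ('D_(dx i) f) ->
  bounded_support f -> (\int[rvm n]_x ('D_(dx i) f x)%:E = 0)%E.
Proof.
elim: n f i => [|n IH] f i df cf sf; first by have := ltn_ord i.
have dom := bounded_support_dominated cf (bounded_support_derive (dx i) sf).
have [E1 E2] := integral_rvmS (dominated_integrable dom).
case: (unliftP ord0 i) => [j|] ij; rewrite {}ij in df cf dom E1 E2 *.
  rewrite [LHS]E1; apply: integral0_eq => t _ /=.
  under eq_integral do rewrite derive_consS.
  apply: IH.
  - by move=> y; apply: derivable_consS; exact: df.
  - have := (dominated_slice t dom).1.
    by rewrite (_ : (fun y => _) = 'D_(dx j) (fun z => f (cons_rv t z)))//;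
      apply/funext => y; rewrite derive_consS.
  - have [B fB] := sf; exists B => y By; apply: fB; rewrite (lt_le_trans By)//.
    apply/rv_norm_leP => // k; rewrite -(cons_rvS t y k).
    exact: (rv_norm_leP _ (normr_ge0 _)).1.
rewrite [LHS]E2; apply: integral0_eq => y _ /=.
under eq_integral do rewrite derive_cons0.
have [B fB] := sf.
apply: (@integral_derive1_eq0 _ B).
- by move=> t; apply: derivable_cons0; exact: df.
- rewrite (_ : 'D_1 (fun s : R => f (cons_rv s y)) =
    (fun t => 'D_(dx ord0) f (cons_rv t y))); last first.
    by apply/funext => t; rewrite derive_cons0.
  exact: (@continuous_slice0 R n ('D_(dx ord0) f) y cf).
- move=> t Bt; apply: fB; rewrite (lt_le_trans Bt)//.
  rewrite -{1}(cons_rv0 t y); exact: (rv_norm_leP _ (normr_ge0 _)).1.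
Qed.

End divergence.

(** * Smoothness of explicit expressions, including a flat function *)

Section smooth_functions.
Variable R : realType.
Local Notation dx i := (delta_mx 0 i).

Lemma derive_comp1 n (f : 'rV[R]_n -> R) (h : R -> R) (c : R) x v :
  differentiable f x -> is_derive (f x) 1 h c ->
  differentiable (h \o f) x /\ 'D_v (h \o f) x = c * 'D_v f x.
Proof.
move=> df [dh hc]; have dh' : differentiable h (f x) by apply/derivable1_diffP.
have dhf : differentiable (h \o f) x by apply: differentiable_comp.
split=> //; rewrite deriveE// diff_comp//= diff1E// derive1E hc deriveE//.
by rewrite /GRing.scale /= mulrC.
Qed.

Lemma derive_coord n (i : 'I_n) (x v : 'rV[R]_n) :
  'D_v (fun y : 'rV[R]_n => y ord0 i) x = v ord0 i.
Proof.
rewrite /derive; apply: lim_near_cst => //.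
near=> h; have h0 : h != 0 by near: h; exact: nbhs_dnbhs_neq.
by rewrite /= !mxE addrK /GRing.scale /= mulKf.
Unshelve. all: by end_near.
Qed.

(* [flat j] is t^-j exp(-1/t) on t > 0, extended by 0: the family is closed
   under differentiation up to linear combinations. *)
Definition flat (j : nat) (t : R) : R :=
  if 0 < t then t^-1 ^+ j * expR (- t^-1) else 0.

Lemma flat_ge0 j t : 0 <= flat j t.
Proof.
by rewrite /flat; case: ifPn => // t0; rewrite mulr_ge0 ?expR_ge0 ?exprn_ge0 ?invr_ge0 ?ltW.
Qed.

(** With u = 1/t and M = j + N this is u^M <= M^M exp u, the M-th power of u/M <= exp(u/M). N = 2
    yields differentiability at 0, N = 0 a uniform bound. *)
Lemma flat_le j N t : (0 < j + N)%N -> 0 < t ->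
  flat j t <= (j + N)%:R ^+ (j + N) * t ^+ N.
Proof.
move=> M0 t0; rewrite /flat t0; set M := (j + N)%N; set u := t^-1.
have u0 : 0 < u by rewrite invr_gt0.
have Mp : 0 < M%:R :> R by rewrite ltr0n.
have key : u ^+ M <= M%:R ^+ M * expR u.
  have -> : expR u = expR (u / M%:R) ^+ M.
    by rewrite -expRM_natl mulrC divfK// gt_eqF.
  rewrite -exprMn lerXn2r ?nnegrE ?mulr_ge0 ?expR_ge0 ?(ltW u0) ?(ltW Mp)//.
  rewrite mulrC -ler_pdivrMr// (le_trans _ (expR_ge1Dx _))// lerDr//.
have -> : t ^+ N = u ^+ j / u ^+ M.
  by rewrite /u /M exprD invfM mulrA divff ?mul1r ?expf_neq0 ?invr_neq0 ?gt_eqF// exprVn invrK.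
rewrite mulrCA; apply: ler_wpM2l; first by rewrite exprn_ge0 ?ltW.
by rewrite ler_pdivlMr ?exprn_gt0// expRN mulrC ler_pdivrMr ?expR_gt0.
Qed.

Lemma is_derive_flat (j : nat) (t : R) :
  is_derive t 1 (flat j) (flat j.+2 t - j%:R * flat j.+1 t).
Proof.
have [t0|t0|->] := ltgtP t 0.
- rewrite {2 3}/flat ltNge (ltW t0) /= mulr0 subr0.
  apply: (@near_eq_is_derive _ _ _ (cst 0)) => //.
    near=> s; rewrite /flat ltNge ltW//; near: s; exact: lt_nbhsl.
- pose g (s : R) := s^-1 ^+ j * expR (- s^-1).
  apply: (@near_eq_is_derive _ _ _ g) => //.
    near=> s; rewrite /flat ifT//; near: s; exact: lt_nbhsr.
  rewrite /flat t0.
  have tn0 : t != 0 by rewrite gt_eqF.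
  have d1 : is_derive t (1 : R) (fun s : R => s^-1) (- t ^- 2).
    by apply: is_derive_eq; [exact: is_deriveV|rewrite /GRing.scale /= mulr1].
  have d2 : is_derive t (1 : R) (fun s : R => expR (- s^-1)) (expR (- t^-1) * t ^- 2).
    apply: (@is_derive1_comp R expR (fun s : R => - s^-1)).
    by apply: is_derive_eq; rewrite opprK.
  have d3 : is_derive t (1 : R) (fun s : R => s^-1 ^+ j) (j%:R * t^-1 ^+ j.-1 * (- t ^- 2)).
    elim: (j) => [|i IH]; first by rewrite !mul0r; exact: (is_derive_cst (1 : R) t 1).
    rewrite (_ : (fun _ => _) = (fun s : R => s^-1) * (fun s => s^-1 ^+ i)); last first.
      by apply/funext => s; rewrite exprS.
    apply: is_derive_eq; rewrite /GRing.scale /= -!exprVn.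
    by case: (i) => [|l] /=; rewrite ?exprS -?natr1; ring.
  have -> : g = (fun s : R => s^-1 ^+ j) * (fun s : R => expR (- s^-1)) by [].
  apply: is_derive_eq; rewrite /GRing.scale /=; case: (j) => [|l].
    by rewrite !mul0r subr0 mulr0 addr0 !expr0 mul1r exprVn mulrC.
  by rewrite -!exprVn /= !exprS; ring.
(* At the junction the difference quotient vanishes for h <= 0 and, by [flat_le] with N = 2, is at
   most a multiple of h for h > 0. *)
- have f0 i : flat i 0 = 0 by rewrite /flat ltxx.
  rewrite !f0 mulr0 subr0.
  suff h : h^-1 *: (flat j (h *: 1 + 0) - flat j 0) @[h --> 0^'] --> (0 : R).
    by split; [apply/cvg_ex; exists 0|apply/cvg_lim].
  apply/cvgr0Pnorm_le => e e0; near=> h.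
  rewrite f0 subr0 addr0 /GRing.scale /= mulr1.
  have [h0|h0] := ltP 0 h; last by rewrite /flat ltNge h0 /= mulr0 normr0 ltW.
  rewrite ger0_norm ?mulr_ge0 ?flat_ge0 ?invr_ge0 ?(ltW h0)//.
  have C0 : 0 < (j + 2)%:R ^+ (j + 2) :> R by rewrite exprn_gt0// ltr0n addn2.
  rewrite mulrC ler_pdivrMr//; apply: le_trans (@flat_le j 2 h _ h0) _.
    by rewrite addn2.
  rewrite expr2 mulrA ler_pM2r// mulrC -ler_pdivlMr//.
  rewrite -[h]ger0_norm ?(ltW h0)//; near: h.
  by apply: dnbhs0_le; rewrite divr_gt0.
Unshelve. all: by end_near.
Qed.

(** A class of expressions closed under every directional derivative and made of differentiable
    functions. Its members are therefore smooth, and no iterated derivative of a test function has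
    to be computed. *)
Inductive smexpr n : ('rV[R]_n -> R) -> Prop :=
| smexpr_smooth f of smooth f : smexpr f
| smexpr_cst c : smexpr (fun=> c)
| smexpr_coord i : smexpr (fun x => x ord0 i)
| smexpr_add f g of smexpr f & smexpr g : smexpr (fun x => f x + g x)
| smexpr_mul f g of smexpr f & smexpr g : smexpr (fun x => f x * g x)
| smexpr_powR f p of (forall x, 0 < f x) & smexpr f : smexpr (fun x => f x `^ p)
| smexpr_flat f j of smexpr f : smexpr (fun x => flat j (f x)).

Lemma smexpr_derive n (f : 'rV[R]_n -> R) : smexpr f ->
  (forall x, differentiable f x) /\ (forall v, smexpr ('D_v f)).
Proof.
elim=> {f} [f sf|c|i|f g _ [df sf] _ [dg sg]|f g sf0 [df sf] sg0 [dg sg]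
    |f p f0 sf0 [df sf]|f j sf0 [df sf]].
- split=> [x|v]; first exact: (sf [::]).
  apply: smexpr_smooth => l x.
  by have := sf (rcons l v) x; rewrite /iter_D foldr_rcons.
- split=> [x|v]; first exact: differentiable_cst.
  rewrite (_ : 'D_v _ = fun=> 0); first exact: smexpr_cst.
  by apply/funext => x; exact: derive_cst.
- split=> [x|v]; first exact: differentiable_coord.
  rewrite (_ : 'D_v _ = fun=> v ord0 i); first exact: smexpr_cst.
  by apply/funext => x; exact: derive_coord.
- split=> [x|v]; first exact: differentiableD.
  rewrite (_ : 'D_v _ = fun x => 'D_v f x + 'D_v g x); first exact: smexpr_add.
  by apply/funext => x; apply: deriveD; exact: diff_derivable.
- split=> [x|v]; first exact: differentiableM.
  rewrite (_ : 'D_v _ = fun x => f x * 'D_v g x + g x * 'D_v f x).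
    by apply: smexpr_add; apply: smexpr_mul.
  by apply/funext => x; apply: deriveM; exact: diff_derivable.
- have d x v := derive_comp1 v (df x) (is_derive1_powR p (f0 x)).
  split=> [x|v]; first exact: (d x 0).1.
  rewrite (_ : 'D_v _ = fun x => p * f x `^ (p - 1) * 'D_v f x).
    by apply: smexpr_mul => //; apply: smexpr_mul; [exact: smexpr_cst|exact: smexpr_powR].
  by apply/funext => x; exact: (d x v).2.
- have d x v := derive_comp1 v (df x) (is_derive_flat j (f x)).
  split=> [x|v]; first exact: (d x 0).1.
  rewrite (_ : 'D_v _ = fun x =>
      (flat j.+2 (f x) + - j%:R * flat j.+1 (f x)) * 'D_v f x).
    apply: smexpr_mul => //; apply: smexpr_add; first exact: smexpr_flat.
    by apply: smexpr_mul; [exact: smexpr_cst|exact: smexpr_flat].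
  by apply/funext => x; rewrite mulNr; exact: (d x v).2.
Qed.

Lemma smexprW n (f : 'rV[R]_n -> R) : smexpr f -> smooth f.
Proof.
move=> sf l; suff /smexpr_derive[] : smexpr (iter_D l f) by [].
by elim: l => //= v l /smexpr_derive[_]; apply.
Qed.

Lemma smooth_derivable n (f : 'rV[R]_n -> R) : smooth f -> forall x v, derivable f x v.
Proof. by move=> sf x v; apply: diff_derivable; exact: (sf [::]). Qed.

Lemma smooth_continuous n (f : 'rV[R]_n -> R) : smooth f -> continuous f.
Proof. by move=> sf x; apply: differentiable_continuous; exact: (sf [::] x). Qed.

Lemma smooth_continuous_derive n (f : 'rV[R]_n -> R) v : smooth f -> continuous ('D_v f).
Proof. by move=> sf x; apply: differentiable_continuous; exact: (sf [:: v] x). Qed.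

End smooth_functions.

(** * Linearity and monotonicity of the integral on dominated functions *)

Section dominated_functions.
Variables (R : realType) (n : nat).
Implicit Types f g : 'rV[R]_n -> R.

Lemma dominatedD f g : dominated f -> dominated g -> dominated (fun x => f x + g x).
Proof.
move=> [cf [M [p [np fM]]]] [cg [N [q [nq gN]]]]; split.
  by move=> x; apply: (@cvgD _ _ _ (nbhs x)); [exact: cf|exact: cg].
have n0 : 0 <= n%:R / 2 :> R by rewrite divr_ge0.
have pos f' M' p' : (forall x, `|f' x| <= M' * bracket x `^ (- p')) -> 0 <= M'.
  move=> h; rewrite -(@pmulr_lge0 _ (bracket (0 : 'rV[R]_n) `^ (- p'))).
    exact: le_trans (normr_ge0 _) (h 0).
  by rewrite powR_gt0 ?bracket_gt0.
exists (M + N), (Num.min p q); split; first by rewrite lt_min np nq.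
have le r x : Num.min p q <= r -> bracket (x : 'rV[R]_n) `^ (- r) <= bracket x `^ (- Num.min p q).
  by move=> h; apply: ler_powR; rewrite ?bracket_ge1// lerN2.
move=> x; rewrite (le_trans (ler_normD _ _))// mulrDl; apply: lerD.
- apply: le_trans (fM x) _; apply: ler_wpM2l; first exact: pos fM.
  by apply: le; rewrite ge_min lexx.
- apply: le_trans (gN x) _; apply: ler_wpM2l; first exact: pos gN.
  by apply: le; rewrite ge_min lexx orbT.
Qed.

Lemma dominatedZ (c : R) f : dominated f -> dominated (fun x => c * f x).
Proof.
move=> [cf [M [p [np fM]]]]; split.
  by move=> x; apply: (@cvgM _ _ (nbhs x)); [exact: cvg_cst|exact: cf].
exists (`|c| * M), p; split => // x.
by rewrite normrM -mulrA ler_wpM2l.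
Qed.

Lemma dominated_le f g : continuous f -> dominated g -> (forall x, `|f x| <= g x) ->
  dominated f.
Proof.
move=> cf [_ [M [p [np gM]]]] fg; split => //; exists M, p; split => // x.
exact: le_trans (fg x) (le_trans (ler_norm _) (gM x)).
Qed.

Local Notation I f := (\int[rvm n]_x f x).

Lemma dominated_le_Rintegral f g : dominated f -> dominated g ->
  (forall x, f x <= g x) -> I f <= I g.
Proof. by move=> df dg fg; apply: le_Rintegral => //; exact: dominated_integrable. Qed.

Lemma dominated_RintegralD f g : dominated f -> dominated g ->
  \int[rvm n]_x (f x + g x) = I f + I g.
Proof. by move=> df dg; apply: RintegralD => //; exact: dominated_integrable. Qed.

Lemma dominated_RintegralZ (c : R) f : dominated f ->
  \int[rvm n]_x (c * f x) = c * I f.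
Proof. by move=> df; apply: RintegralZl => //; exact: dominated_integrable. Qed.

End dominated_functions.

(** * The weight W, its gradient and the decay of its powers *)

Section weight.
Variables (R : realType) (n : nat) (D k : R).
Local Notation dx i := (delta_mx 0 i).

Definition weight (x : 'rV[R]_n) : R := D + k * sqnorm x.
Local Notation W := weight.

Lemma smexpr_sum m (f : 'I_m -> 'rV[R]_n -> R) : (forall i, smexpr (f i)) ->
  smexpr (fun x => \sum_(i < m) f i x).
Proof.
elim: m f => [|m IH] f sf.
  rewrite (_ : (fun _ => _) = fun=> 0); first exact: smexpr_cst.
  by apply/funext => x; rewrite big_ord0.
rewrite (_ : (fun _ => _) = fun x => f ord0 x + \sum_(i < m) f (lift ord0 i) x).
  by apply: smexpr_add => //; exact: IH.
by apply/funext => x; rewrite big_ord_recl.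
Qed.

Lemma smexpr_weight : smexpr W.
Proof.
apply: smexpr_add; first exact: smexpr_cst.
apply: smexpr_mul; first exact: smexpr_cst.
by apply: smexpr_sum => i; apply: smexpr_mul; exact: smexpr_coord.
Qed.

Lemma differentiable_weight x : differentiable W x.
Proof. exact: (smexpr_derive smexpr_weight).1. Qed.

Lemma continuous_weight : continuous W.
Proof. by move=> x; apply: differentiable_continuous; exact: differentiable_weight. Qed.

Lemma derive_weight i x : 'D_(dx i) W x = 2 * k * x ord0 i.
Proof.
pose q (j : 'I_n) (y : 'rV[R]_n) : R := y ord0 j * y ord0 j.
have dc j : derivable (fun y : 'rV[R]_n => y ord0 j) x (dx i).
  by apply: diff_derivable; exact: differentiable_coord.
have dq j : derivable (q j) x (dx i) by apply: derivableM.
have -> : W = cst D + k *: (\sum_(j < n) q j).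
  apply/funext => y; rewrite /W /sqnorm; congr (_ + _ * _).
  by rewrite fct_sumE; apply: eq_bigr => j _; rewrite expr2.
rewrite deriveD//; last by apply: derivableZ; exact: derivable_sum.
rewrite derive_cst add0r deriveZ; last exact: derivable_sum.
rewrite derive_sum// (bigD1 i)//= big1; last first.
  move=> j ji; rewrite /q deriveM// ?derive_coord.
  by rewrite mxE eqxx /= (negbTE ji) !scaler0 addr0.
rewrite /q deriveM// ?derive_coord.
rewrite mxE !eqxx /GRing.scale /=; ring.
Qed.

Lemma derive_weight_comp (h : R -> R) (c : R) i x : is_derive (W x) 1 h c ->
  derivable (h \o W) x (dx i) /\ 'D_(dx i) (h \o W) x = c * (2 * k * x ord0 i).
Proof.
move=> dh; have [d ->] := derive_comp1 (dx i) (differentiable_weight x) dh.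
by rewrite derive_weight; split => //; exact: diff_derivable.
Qed.

Hypotheses (D0 : 0 < D) (k0 : 0 < k).

Lemma weight_ge (x : 'rV[R]_n) : D <= W x.
Proof. by rewrite lerDl mulr_ge0 ?sqnorm_ge0// ltW. Qed.

Lemma weight_gt0 (x : 'rV[R]_n) : 0 < W x.
Proof. exact: lt_le_trans D0 (weight_ge x). Qed.

Lemma sqnorm_weight (x : 'rV[R]_n) : k * sqnorm x <= W x.
Proof. by rewrite lerDr ltW. Qed.

Lemma continuous_weight_powR p : continuous (fun x => W x `^ p).
Proof. by apply: continuous_powR_comp; [exact: weight_gt0|exact: continuous_weight]. Qed.

(** W is at least min(D, k) times 1 + |x|^2. *)
Lemma dominated_weight_powR p : n%:R / 2 < p -> dominated (fun x => W x `^ (- p)).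
Proof.
move=> np; split; first exact: continuous_weight_powR.
have p0 : 0 <= p by rewrite (le_trans _ (ltW np))// divr_ge0.
pose c := Num.min D k; have c0 : 0 < c by rewrite lt_min D0.
exists (c `^ (- p)), p; split => // x.
rewrite ger0_norm ?powR_ge0// -powRM ?(ltW c0) ?(ltW (bracket_gt0 _))//.
apply: ler_powRN => //; first by rewrite mulr_gt0 ?bracket_gt0.
rewrite /bracket /W mulrDr mulr1 lerD// ?ler_wpM2r ?sqnorm_ge0 ?ge_min ?lexx ?orbT//.
Qed.

End weight.

(** * The Hardy-type inequality with weight w *)

Section hardy.
Variables (R : realType) (n : nat) (D k a : R).
Hypotheses (D0 : 0 < D) (k0 : 0 < k).
Local Notation dx i := (delta_mx 0 i).
Local Notation W := (@weight R n D k).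

Lemma continuous_sqgrad (h : 'rV[R]_n -> R) : smooth h -> continuous (sqgrad h).
Proof.
move=> sh x; rewrite /sqgrad.
apply: (@cvg_big _ _ _ _ _ _ _ (nbhs x)); first exact: add_continuous.
by move=> i _; apply: (@cvgM _ _ (nbhs x)); exact: smooth_continuous_derive.
Qed.

Lemma bounded_support_sqgrad (h : 'rV[R]_n -> R) :
  bounded_support h -> bounded_support (sqgrad h).
Proof.
move=> sh.
have /fin_all_exists[B hB] : forall i : 'I_n, exists B : R,
    forall x, B < `|x| -> 'D_(dx i) h x = 0.
  by move=> i; exact: (bounded_support_derive (dx i) sh).
exists (\big[Num.max/0]_i B i) => x Bx; rewrite /sqgrad big1// => i _.
by rewrite hB ?expr0n// (le_lt_trans _ Bx)// le_bigmax.
Qed.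

Lemma continuousM_rv (f g : 'rV[R]_n -> R) : continuous f -> continuous g ->
  continuous (fun x => f x * g x).
Proof. by move=> cf cg x; apply: (@cvgM _ _ (nbhs x)); [exact: cf|exact: cg]. Qed.

Lemma bounded_supportMr (f g : 'rV[R]_n -> R) : bounded_support f ->
  bounded_support (fun x => f x * g x).
Proof. by move=> [B fB]; exists B => x Bx; rewrite fB// mul0r. Qed.

(** No sign is imposed on lam, so the same inequality serves both parts of the theorem. *)
Lemma hardy_weight (h : 'rV[R]_n -> R) (lam := (n%:R + 2 * a - 2) * k / 2) :
  smooth h -> bounded_support h ->
  \int[rvm n]_x (h x ^+ 2 * (W x `^ (a - 2) * (lam * n%:R * D + lam ^+ 2 * sqnorm x)))
  <= \int[rvm n]_x (sqgrad h x * W x `^ a).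
Proof.
move=> sh bh.
(* The components of the vector field whose divergence is integrated. *)
pose phi i (x : 'rV[R]_n) := h x * h x * (lam * x ord0 i * W x `^ (a - 1)).
have sphi i : smooth (phi i).
  apply: smexprW; apply: smexpr_mul; first by apply: smexpr_mul; exact: smexpr_smooth.
  apply: smexpr_mul; first by apply: smexpr_mul; [exact: smexpr_cst|exact: smexpr_coord].
  by apply: smexpr_powR; [exact: weight_gt0|exact: smexpr_weight].
have bphi i : bounded_support (phi i) by apply: bounded_supportMr; exact: bounded_supportMr.
have dphi i x : 'D_(dx i) (phi i) x = 2 * lam * h x * 'D_(dx i) h x * x ord0 i * W x `^ (a - 1)
    + h x ^+ 2 * lam * (W x `^ (a - 1) + 2 * k * (a - 1) * x ord0 i ^+ 2 * W x `^ (a - 2)).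
  have dh : is_derive x (dx i) h ('D_(dx i) h x).
    by apply: DeriveDef => //; exact: smooth_derivable.
  have dc : is_derive x (dx i) (fun y : 'rV[R]_n => y ord0 i) 1.
    apply: DeriveDef; first by apply: diff_derivable; exact: differentiable_coord.
    by rewrite derive_coord mxE !eqxx.
  have dw : is_derive x (dx i) (fun y : 'rV[R]_n => W y `^ (a - 1))
      ((a - 1) * W x `^ (a - 1 - 1) * (2 * k * x ord0 i)).
    have [d1 d2] := derive_weight_comp i (is_derive1_powR (a - 1) (weight_gt0 D0 k0 x)).
    exact: DeriveDef.
  have [_] := is_deriveM (is_deriveM dh dh) (is_deriveM (is_deriveZ lam dc) dw).
  rewrite (_ : a - 1 - 1 = a - 2); last by ring.
  move=> E; rewrite [LHS]E /GRing.scale /=.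
  have -> : (h * h) x = h x * h x by [].
  have -> : ((fun y : 'rV[R]_n => lam * y ord0 i) * (fun y => W y `^ (a - 1))) x =
    lam * x ord0 i * W x `^ (a - 1) by [].
  have -> : lam *: x ord0 i = lam * x ord0 i by [].
  by ring.
have cphi i := @smooth_continuous_derive R n (phi i) (dx i) (sphi i).
have domphi i : dominated ('D_(dx i) (phi i)).
  by apply: bounded_support_dominated => //; exact: bounded_support_derive.
have int0 : \int[rvm n]_x (\sum_(i < n) 'D_(dx i) (phi i) x) = 0.
  rewrite /Rintegral; under eq_integral do rewrite -sumEFin.
  rewrite integral_sum//; last by move=> i; exact: (dominated_integrable (domphi i)).
  rewrite big1// => i _; apply: integral_derive_eq0 => // x; exact: smooth_derivable.
have domsum : dominated (fun x => \sum_(i < n) 'D_(dx i) (phi i) x).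
  apply: bounded_support_dominated.
    move=> x; apply: (@cvg_big _ _ _ _ _ _ _ (nbhs x)); first exact: add_continuous.
    by move=> i _; exact: cphi.
  have /fin_all_exists[B hB] : forall i : 'I_n, exists B : R,
      forall x, B < `|x| -> 'D_(dx i) (phi i) x = 0.
    by move=> i; exact: (bounded_support_derive (dx i) (bphi i)).
  exists (\big[Num.max/0]_i B i) => x Bx; rewrite big1// => i _.
  by rewrite hB// (le_lt_trans _ Bx)// le_bigmax.
have ch := smooth_continuous sh.
have domG : dominated (fun x => sqgrad h x * W x `^ a).
  apply: bounded_support_dominated; last exact/bounded_supportMr/bounded_support_sqgrad.
  by apply: continuousM_rv; [exact: continuous_sqgrad|exact: continuous_weight_powR].
(* Adding the divergence, of integral zero, to the right side makes the inequality pointwise: the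
   difference is W^(a-2) times the sum of the squares of the components of W grad h + lam h x. *)
rewrite -[leRHS]addr0 -int0 -dominated_RintegralD//.
apply: dominated_le_Rintegral; [|exact: dominatedD|].
  apply: bounded_support_dominated; last first.
    by apply: bounded_supportMr; rewrite (_ : (fun _ => _) = fun x => h x * h x);
      [exact: bounded_supportMr|apply/funext => x; rewrite expr2].
  apply: continuousM_rv; first exact: continuousM_rv.
  apply: continuousM_rv; first exact: continuous_weight_powR.
  move=> x; apply: (@cvgD _ _ _ (nbhs x)); first exact: cvg_cst.
  by apply: (@cvgM _ _ (nbhs x)); [exact: cvg_cst|exact: continuous_sqnorm].
move=> x; under eq_bigr do rewrite dphi.
have W0 := weight_gt0 D0 k0 x.
set P := W x `^ (a - 2).
have E1 : W x `^ (a - 1) = P * W x.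
  by rewrite (_ : a - 1 = a - 2 + 1); [rewrite gt0_powRD// powRr1 ?ltW|ring].
have E0 : W x `^ a = P * W x ^+ 2.
  rewrite -[a in LHS](subrK 2) gt0_powRD//; congr (_ * _).
  by rewrite -[2 in LHS]/(2%:R) powR_mulrn// ltW.
rewrite E1 E0 /sqgrad -subr_ge0.
have -> : (\sum_(i < n) ('D_(dx i) h x) ^+ 2) * (P * W x ^+ 2) +
   \sum_(i < n) (2 * lam * h x * 'D_(dx i) h x * x ord0 i * (P * W x) +
     h x ^+ 2 * lam * (P * W x + 2 * k * (a - 1) * x ord0 i ^+ 2 * P)) -
   h x ^+ 2 * (P * (lam * n%:R * D + lam ^+ 2 * sqnorm x)) =
   P * \sum_(i < n) (W x * 'D_(dx i) h x + lam * h x * x ord0 i) ^+ 2.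
  set N := sqnorm x; set G := \sum_(i < n) ('D_(dx i) h x) ^+ 2.
  pose S := \sum_(i < n) 'D_(dx i) h x * x ord0 i.
  have S1 : \sum_(i < n) (2 * lam * h x * 'D_(dx i) h x * x ord0 i * (P * W x) +
      h x ^+ 2 * lam * (P * W x + 2 * k * (a - 1) * x ord0 i ^+ 2 * P)) =
      2 * lam * h x * P * W x * S + h x ^+ 2 * lam * P * W x * n%:R +
      2 * k * (a - 1) * h x ^+ 2 * lam * P * N.
    have cn (c : R) : c * n%:R = \sum_(i < n) c by rewrite sumr_const card_ord mulr_natr.
    rewrite /S /N /sqnorm !mulr_sumr cn.
    by rewrite -!big_split /=; apply: eq_bigr => i _; ring.
  have S2 : \sum_(i < n) (W x * 'D_(dx i) h x + lam * h x * x ord0 i) ^+ 2 =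
      W x ^+ 2 * G + 2 * lam * h x * W x * S + lam ^+ 2 * h x ^+ 2 * N.
    rewrite /S /N /G /sqnorm !mulr_sumr.
    by rewrite -!big_split /=; apply: eq_bigr => i _; ring.
  by rewrite S1 S2 (_ : W x = D + k * N)// /lam; field.
by rewrite mulr_ge0 ?powR_ge0// sumr_ge0// => i _; exact: sqr_ge0.
Qed.

End hardy.

(** * A smooth cutoff whose errors are powers of w / rho *)

Section cutoff.
Variable R : realType.
Implicit Types rho w e : R.

(** Equal to exp(1 - 1/(1 - w/rho)) for w < rho and to 0 beyond; the factor [expR 1] normalises the
    value at w = 0 to 1. *)
Definition cutoff rho w : R := expR 1 * flat 0 (1 - w / rho).
Definition dcutoff rho w : R := - (expR 1 / rho * flat 2 (1 - w / rho)).

Lemma cutoff_ge0 rho w : 0 <= cutoff rho w.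
Proof. by rewrite mulr_ge0 ?expR_ge0 ?flat_ge0. Qed.

Lemma flat_eq0 j (t : R) : t <= 0 -> flat j t = 0.
Proof. by move=> t0; rewrite /flat ltNge t0. Qed.

Lemma cutoff_eq0 rho w : 0 < rho -> rho <= w -> cutoff rho w = 0.
Proof.
move=> r0 rw; rewrite /cutoff flat_eq0 ?mulr0// subr_le0.
by rewrite ler_pdivlMr// mul1r.
Qed.

Lemma cutoffE rho w : 0 < rho -> w < rho ->
  cutoff rho w = expR (1 - (1 - w / rho)^-1).
Proof.
move=> r0 wr; rewrite /cutoff /flat subr_gt0 ltr_pdivrMr// mul1r wr expr0 mul1r.
by rewrite -expRD.
Qed.

Lemma cutoff_le1 rho w : 0 < rho -> 0 <= w -> cutoff rho w <= 1.
Proof.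
move=> r0 w0; have [wr|rw] := ltP w rho; last by rewrite cutoff_eq0.
rewrite cutoffE// -[leRHS]expR0 ler_expR subr_le0 invf_ge1.
  by rewrite gerBl divr_ge0// ltW.
by rewrite subr_gt0 ltr_pdivrMr// mul1r.
Qed.

(** The mass lost by cutting off, paid for with a power of w and gaining rho^-e. The exponent e
    stays free so that it can be fitted to the available integrability. *)
Lemma cutoff_tail rho w e : 0 < rho -> 0 < w -> 0 <= e -> e <= 1 ->
  1 - cutoff rho w ^+ 2 <= 4 * (w / rho) `^ e.
Proof.
move=> r0 w0 e0 e1; set th := w / rho; have th0 : 0 < th by rewrite divr_gt0.
have [h1|h1] := leP 1 th.
  have : 1 <= th `^ e by rewrite -(powRr0 th); apply: ler_powR.
  by have := sqr_ge0 (cutoff rho w); lra.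
have the : th <= th `^ e by apply: ger1_powR => //; rewrite th0 ltW.
apply: (@le_trans _ _ (4 * th)); last by rewrite ler_pM2l.
(* For th > 1/2 the right side exceeds 1. Otherwise exp u >= 1 + u bounds the left side by 2 th / (1
   - th), which is at most 4 th. *)
have [h2|h2] := leP th 2^-1; last by have := sqr_ge0 (cutoff rho w); lra.
have wr : w < rho by move: h1; rewrite /th ltr_pdivrMr// mul1r.
rewrite cutoffE// -/th -expRM_natl.
have := expR_ge1Dx (2%:R * (1 - (1 - th)^-1)).
have th1 : 0 < 1 - th by lra.
have -> : 1 - (1 - th)^-1 = - (th / (1 - th)) by field; lra.
have : th / (1 - th) <= 2 * th by rewrite ler_pdivrMr//; nra.
lra.
Qed.

Lemma is_derive_cutoff rho w : is_derive w 1 (cutoff rho) (dcutoff rho w).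
Proof.
have d1 : is_derive w (1 : R) (fun s : R => 1 - s / rho) (- rho^-1).
  have -> : (fun s : R => 1 - s / rho) = (cst 1 - rho^-1 *: id : R -> R).
    by apply/funext => s; rewrite /GRing.scale /= mulrC.
  by apply: is_derive_eq; rewrite sub0r /GRing.scale /= mulr1.
have d2 := @is_derive1_comp R (flat 0) (fun s : R => 1 - s / rho) w _ _
  (is_derive_flat 0 (1 - w / rho)) d1.
have -> : cutoff rho = expR 1 *: (flat 0 \o (fun s : R => 1 - s / rho)) by [].
apply: is_derive_eq; rewrite /dcutoff /GRing.scale /=; ring.
Qed.

(* 4 bounds [flat 2]. *)
Lemma dcutoff_le rho w : 0 < rho -> 0 < w ->
  `|dcutoff rho w * w| <= 4 * expR 1 * Num.min 1 (w / rho).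
Proof.
move=> r0 w0; have [rw|wr] := leP rho w.
  rewrite /dcutoff flat_eq0 ?mulr0 ?oppr0 ?mul0r ?normr0.
    by rewrite !mulr_ge0 ?expR_ge0// le_min ler01 divr_ge0// ltW.
  by rewrite subr_le0 ler_pdivlMr// mul1r.
have t0 : 0 < 1 - w / rho by rewrite subr_gt0 ltr_pdivrMr// mul1r.
rewrite /dcutoff mulNr normrN ger0_norm; last first.
  by rewrite !mulr_ge0 ?expR_ge0 ?flat_ge0 ?invr_ge0// ltW.
have f4 : flat 2 (1 - w / rho) <= 4.
  have := @flat_le R 2 0 (1 - w / rho) isT t0.
  by rewrite expr0 mulr1 addn0 -natrX.
have -> : expR 1 / rho * flat 2 (1 - w / rho) * w = expR 1 * (flat 2 (1 - w / rho) * (w / rho)).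
  by field; rewrite gt_eqF.
have -> (m : R) : 4 * expR 1 * m = expR 1 * (4 * m) by ring.
rewrite ler_pM2l ?expR_gt0//.
rewrite min_r; last by rewrite ler_pdivrMr// mul1r ltW.
by rewrite ler_pM2r// divr_gt0.
Qed.

(** Both min(1, w/rho) and its square are at most (w/rho)^e when e lies between 0 and 1. *)
Lemma dcutoff_powR_le rho w e : 0 < rho -> 0 < w -> 0 <= e -> e <= 1 ->
  `|dcutoff rho w * w| <= 4 * expR 1 * (w / rho) `^ e /\
  (dcutoff rho w * w) ^+ 2 <= (4 * expR 1) ^+ 2 * (w / rho) `^ e.
Proof.
move=> r0 w0 e0 e1; have := dcutoff_le r0 w0.
set d := dcutoff _ _ * w; set K := 4 * expR 1; set m := Num.min _ _ => dK.
have K0 : 0 < K by rewrite mulr_gt0 ?expR_gt0.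
have th0 : 0 < w / rho by rewrite divr_gt0.
have m0 : 0 <= m by rewrite le_min ler01 ltW.
have m1 : m <= 1 by rewrite ge_min lexx.
have mt : m <= (w / rho) `^ e.
  rewrite /m; have [h|h] := leP 1 (w / rho).
    by rewrite -[leLHS](powRr0 (w / rho)); apply: ler_powR.
  by apply: ger1_powR => //; rewrite th0 ltW.
split; first by rewrite (le_trans dK)// ler_pM2l.
rewrite -real_normK ?num_real//.
have /le_trans -> // : `|d| ^+ 2 <= (K * m) ^+ 2.
  by rewrite lerXn2r ?nnegrE// mulr_ge0// ltW.
rewrite exprMn ler_pM2l ?exprn_gt0//; nra.
Qed.

End cutoff.

(** * The cutoff composed with W *)

Section cutoff_weight.
Variables (R : realType) (n : nat) (D k : R).
Hypotheses (D0 : 0 < D) (k0 : 0 < k).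
Local Notation dx i := (delta_mx 0 i).
Local Notation W := (@weight R n D k).

(** |grad W|^2 = 4 k^2 |x|^2 = 4 k (W - D). Dropping D costs little where W is large, which is where
    the near-optimisers have their mass, so the bound is sharp enough for optimality. *)
Lemma sqgrad_weight_comp (h : R -> R) c x : is_derive (W x) 1 h c ->
  sqgrad (h \o W) x <= 4 * k * c ^+ 2 * W x.
Proof.
move=> dh; rewrite /sqgrad.
have E i : 'D_(dx i) (h \o W) x = c * (2 * k * x ord0 i).
  by have [] := @derive_weight_comp R n D k h c i x dh.
under eq_bigr do rewrite E.
have -> : \sum_(i < n) (c * (2 * k * x ord0 i)) ^+ 2 = 4 * k * c ^+ 2 * (k * sqnorm x).
  by rewrite /sqnorm !mulr_sumr; apply: eq_bigr => i _; ring.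
apply: ler_wpM2l; last exact: sqnorm_weight.
by rewrite mulr_ge0 ?sqr_ge0// mulr_ge0// ltW.
Qed.

Lemma smexpr_cutoff rho : smexpr (fun x => cutoff rho (W x)).
Proof.
rewrite /cutoff; apply: smexpr_mul; first exact: smexpr_cst.
apply: smexpr_flat; rewrite (_ : (fun _ => _) = fun x => 1 + - rho^-1 * W x).
  apply: smexpr_add; first exact: smexpr_cst.
  by apply: smexpr_mul; [exact: smexpr_cst|exact: smexpr_weight].
by apply/funext => x; rewrite mulNr mulrC.
Qed.

Lemma bounded_support_cutoff rho : 0 < rho ->
  bounded_support (fun x => cutoff rho (W x)).
Proof.
move=> r0; exists (Num.sqrt (rho / k)) => x Bx; apply: cutoff_eq0 => //.
have s0 : 0 <= rho / k by rewrite divr_ge0// ltW.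
have [i xi] : exists i, Num.sqrt (rho / k) < `|x ord0 i|.
  apply: contrapT => /forallNP h; move: Bx; rewrite ltNge => /negP; apply.
  by apply/rv_norm_leP; [exact: sqrtr_ge0|move=> i; rewrite leNgt; apply/negP/h].
have : rho / k < x ord0 i ^+ 2.
  rewrite -(sqr_sqrtr s0) -[ltRHS]real_normK ?num_real// ltrXn2r// ?nnegrE ?sqrtr_ge0//.
rewrite ltr_pdivrMr// mulrC => /ltW/le_trans; apply.
apply: (@le_trans _ _ (k * sqnorm x)); last exact: sqnorm_weight.
by rewrite ler_pM2l//; exact: coord_sqr_le.
Qed.

Lemma sqgrad_cutoff rho e x : 0 < rho -> 0 <= e -> e <= 1 ->
  sqgrad (fun x => cutoff rho (W x)) x <=
  4 * k * (4 * expR 1) ^+ 2 * rho `^ (- e) * W x `^ (e - 1).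
Proof.
move=> r0 e0 e1; have W0 := weight_gt0 D0 k0 x.
apply: le_trans (sqgrad_weight_comp (is_derive_cutoff rho (W x))) _.
have [_ h] := dcutoff_powR_le r0 W0 e0 e1.
have -> : 4 * k * dcutoff rho (W x) ^+ 2 * W x =
    4 * k * ((dcutoff rho (W x) * W x) ^+ 2 / W x) by field; rewrite gt_eqF.
apply: (@le_trans _ _ (4 * k * ((4 * expR 1) ^+ 2 * (W x / rho) `^ e / W x))).
  by rewrite ler_pM2l ?mulr_gt0// ler_pM2r ?invr_gt0.
have -> : (W x / rho) `^ e = rho `^ (- e) * (W x `^ (e - 1) * W x).
  rewrite powRM ?invr_ge0 ?(ltW W0) ?(ltW r0)// mulrC.
  rewrite -[in X in _ = _ * (_ * X)](powRr1 (ltW W0)) -gt0_powRD// subrK.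
  by rewrite -powR_inv1 ?(ltW r0)// -powRrM mulN1r.
by rewrite le_eqVlt; apply/orP; left; apply/eqP; field; rewrite gt_eqF.
Qed.

End cutoff_weight.

(** * A Poincare inequality on cubes centred at the origin *)

Section cube.
Variables (R : realType) (r : R).
Hypothesis r0 : 0 < r.
Local Notation mu := (@lebesgue_measure R).
Local Notation dx i := (delta_mx 0 i).
Local Notation I := (`[- r, r]%classic : set (measurableTypeR R)).

Definition cube n : set (rVm R n) := [set x | forall i, (`|x ord0 i| <= r)%R].

Lemma measurable_cube n : measurable (@cube n).
Proof.
have -> : @cube n = \bigcap_(i in [set: 'I_n]) ((fun x : rVm R n => x ord0 i) @^-1` I).
  apply/seteqP; split => [x xc i _|x xc i]; first by rewrite /= in_itv /= -ler_norml.
  by have := xc i Logic.I; rewrite /= in_itv /= -ler_norml.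
apply: fin_bigcap_measurable => // i _; rewrite -[X in measurable X]setTI.
by apply: measurable_coord => //; exact: measurable_itv.
Qed.

Lemma cube_cons n t (y : 'rV[R]_n) : cube (cons_rv t y) <-> I t /\ cube y.
Proof.
rewrite /= in_itv /= -ler_norml; split => [c|[tr yc] i].
  by split => [|i]; [have := c ord0; rewrite cons_rv0|have := c (lift ord0 i); rewrite cons_rvS].
by case: (unliftP ord0 i) => [j ->|->]; rewrite ?cons_rvS ?cons_rv0.
Qed.

Section tonelli.
Variables (n : nat) (f : rVm R n.+1 -> \bar R).
Hypotheses (mf : measurable_fun [set: rVm R n.+1] f) (f0 : forall x, (0 <= f x)%E).

Let fc (p : measurableTypeR R * rVm R n) : \bar R := f (cons_rv p.1 p.2).
(** Extension by zero from a rectangle, so that Tonelli's theorem on the whole product applies; A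
    and B vary because slice measurability is wanted with only one factor restricted. *)
Let G A B := fc \_ (A `*` B).

Let mG A B : measurable A -> measurable B -> measurable_fun setT (G A B).
Proof.
move=> mA mB; apply/(measurable_restrictT _ _).1; first exact: measurableX.
apply: measurable_funTS; exact: (measurable_comp measurableT _ mf (@measurable_cons_rv R n)).
Qed.

Let G0 A B p : (0 <= G A B p)%E.
Proof. by apply: erestrict_ge0 => q _; exact: f0. Qed.

Let GE A B t y : A t -> G A B (t, y) = ((fun y => f (cons_rv t y)) \_ B) y.
Proof. by move=> At; rewrite /G !patchE in_setX /= (mem_set At). Qed.

Let GE' A B t y : B y -> G A B (t, y) = ((fun t => f (cons_rv t y)) \_ A) t.
Proof. by move=> By; rewrite /G !patchE in_setX /= (mem_set By) andbT. Qed.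

Let GN A B t y : ~ A t -> G A B (t, y) = 0.
Proof. by move=> At; rewrite /G !patchE in_setX /= (memNset At). Qed.

Let GN' A B t y : ~ B y -> G A B (t, y) = 0.
Proof. by move=> By; rewrite /G !patchE in_setX /= (memNset By) andbF. Qed.

Lemma measurable_cube_slice0 : measurable_fun [set: measurableTypeR R]
  (fun t : measurableTypeR R => \int[rvm n]_(y in @cube n) f (cons_rv t y))%E.
Proof.
have := @measurable_fun_fubini_tonelli_F _ _ _ _ _ (rvm n) (G setT (@cube n))
  (mG measurableT (@measurable_cube n)) (@G0 _ _).
congr measurable_fun; apply/funext => t.
by rewrite [RHS]integral_mkcond; apply: eq_integral => y _; rewrite GE.
Qed.

Lemma measurable_cube_sliceS : measurable_fun [set: rVm R n]
  (fun y : rVm R n => \int[mu]_(t in I) f (cons_rv t y))%E.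
Proof.
have mI : measurable I by exact: measurable_itv.
have := @measurable_fun_fubini_tonelli_G _ _ _ _ _ mu (G I setT)
  (mG mI measurableT) (@G0 _ _).
congr measurable_fun; apply/funext => t.
by rewrite [RHS]integral_mkcond; apply: eq_integral => y _; rewrite GE'.
Qed.

Let cube_integralE : (\int[rvm n.+1]_(x in @cube n.+1) f x =
  \int[mu]_t \int[rvm n]_y G I (@cube n) (t, y))%E.
Proof.
rewrite integral_mkcond ge0_integral_rvmS.
- apply: eq_integral => t _; apply: eq_integral => y _.
  rewrite /G !patchE; congr (if _ then _ else _).
  by apply/idP/idP; rewrite in_setX => /[!inE]; [move/cube_cons => [? ?]; apply/andP; rewrite !inE|
     move/andP; rewrite !inE => ?; exact/cube_cons].
- apply/(measurable_restrictT _ _).1; first exact: measurable_cube.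
  exact: measurable_funTS.
- by move=> x; apply: erestrict_ge0.
Qed.

Lemma cube_integral0 : (\int[rvm n.+1]_(x in @cube n.+1) f x =
  \int[mu]_(t in I) \int[rvm n]_(y in @cube n) f (cons_rv t y))%E.
Proof.
rewrite cube_integralE [RHS]integral_mkcond; apply: eq_integral => t _.
rewrite patchE; case: ifPn => [/set_mem It|/negP It].
  by rewrite [RHS]integral_mkcond; apply: eq_integral => y _; rewrite GE.
by apply: integral0_eq => y _; rewrite GN//; move/mem_set.
Qed.

Lemma cube_integralS : (\int[rvm n.+1]_(x in @cube n.+1) f x =
  \int[rvm n]_(y in @cube n) \int[mu]_(t in I) f (cons_rv t y))%E.
Proof.
have mI : measurable I by exact: measurable_itv.
rewrite cube_integralE fubini_tonelli; last 2 first.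
- exact: (mG mI (@measurable_cube n)).
- by move=> p; exact: G0.
rewrite [RHS]integral_mkcond; apply: eq_integral => y _.
rewrite patchE; case: ifPn => [/set_mem cy|/negP cy].
  by rewrite [RHS]integral_mkcond; apply: eq_integral => t _; rewrite GE'.
by apply: integral0_eq => t _; rewrite GN'//; move/mem_set.
Qed.

End tonelli.

Lemma lebesgue_measure_I : mu I = (2 * r)%:E.
Proof.
have rr : (- r < r)%R by rewrite gtrN.
rewrite lebesgue_measure_itv /= lte_fin rr.
by rewrite -EFinB; congr (_%:E); ring.
Qed.

Lemma cube_volume n : rvm n (@cube n) = ((2 * r) ^+ n)%:E.
Proof.
elim: n => [|n IH].
  have -> : @cube 0 = setT.
    by apply/seteqP; split => // x _ i; have := ltn_ord i.
  by rewrite expr0 /= diracT.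
have -> : (rvm n.+1 (@cube n.+1) = (mu \x rvm n) (I `*` @cube n))%E.
  rewrite /= /cons_measure /pushforward; congr (_ _).
  by apply/seteqP; split => -[t y] /cube_cons.
rewrite product_measure1E; [|exact: measurable_itv|exact: measurable_cube].
by rewrite [X in (X * _)%E]lebesgue_measure_I IH -EFinM exprS.
Qed.

(** Cauchy-Schwarz along a segment, obtained by integrating f'^2 >= 2 c f' - c^2, where c is the
    mean slope. *)
Lemma sqr_increment_le (f : R -> R) (s t : R) : (forall x, derivable f x 1) ->
  continuous ('D_1 f) -> I s -> I t ->
  (((f t - f s) ^+ 2)%:E <= (2 * r)%:E * \int[mu]_(x in I) (('D_1 f x) ^+ 2)%:E)%E.
Proof.
move=> df cf; wlog: s t / (s <= t)%R.
  move=> h Is It; have [st|/ltW ts] := leP s t; first exact: h.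
  by rewrite -opprB sqrrN; exact: h.
rewrite le_eqVlt => /predU1P[-> _ _|st Is It].
  rewrite subrr expr0n /=; apply: mule_ge0; first by rewrite lee_fin mulr_ge0// ltW.
  by apply: integral_ge0 => x _; rewrite lee_fin sqr_ge0.
pose L : R := (t - s)%R; have L0 : (0 < L)%R by rewrite subr_gt0.
pose c : R := ((f t - f s) / L)%R.
(* A primitive of 2 c f' - c^2; its increment from s to t is (f t - f s)^2 / L. *)
pose F (x : R) : R := (2 * c * f x - c ^+ 2 * x)%R.
have dF (x : R) : is_derive x (1 : R) F (2 * c * 'D_1 f x - c ^+ 2)%R.
  have dfx : is_derive x (1 : R) f ('D_1 f x) by apply: DeriveDef.
  have -> : F = ((2 * c) *: f - (c ^+ 2) *: (id : R -> R))%R by [].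
  by apply: is_derive_eq; rewrite /GRing.scale /= mulr1.
have cF : continuous (fun x : R => 2 * c * 'D_1 f x - c ^+ 2)%R.
  by move=> x; apply: cvgB; [apply: cvgM; [exact: cvg_cst|exact: cf]|exact: cvg_cst].
have cf2 : continuous (fun x : R => ('D_1 f x) ^+ 2)%R.
  by move=> x; apply: cvgM; exact: cf.
have ci (h : R -> R) : continuous h -> mu.-integrable `[s, t] (EFin \o h).
  move=> ch; apply: continuous_compact_integrable; first exact: segment_compact.
  exact: continuous_subspaceT.
have E : (\int[mu]_(x in `[s, t]) (2 * c * 'D_1 f x - c ^+ 2)%:E = (F t)%:E - (F s)%:E)%E.
  have cF' x : {for x, continuous F}.
    by apply: differentiable_continuous; apply/derivable1_diffP; case: (dF x).
  apply: continuous_FTC2 => //.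
  - exact: continuous_subspaceT.
  - split; first by move=> x _; case: (dF x).
    + by apply: cvg_at_right_filter; exact: cF'.
    + by apply: cvg_at_left_filter; exact: cF'.
  - by move=> x _; rewrite derive1E; have [_ ->] := dF x.
have le1 : (((f t - f s) ^+ 2 / L)%:E <= \int[mu]_(x in `[s, t]) (('D_1 f x) ^+ 2)%:E)%E.
  have -> : ((f t - f s) ^+ 2 / L)%:E = ((F t)%:E - (F s)%:E)%E.
    by rewrite -EFinB /F /c /L; congr (_%:E); field; rewrite gt_eqF.
  rewrite -E; apply: le_integral => //; [exact: ci|exact: ci|].
  by move=> x _; rewrite lee_fin; have := sqr_ge0 ('D_1 f x - c)%R; nra.
have le2 : (\int[mu]_(x in `[s, t]) (('D_1 f x) ^+ 2)%:E <=
    \int[mu]_(x in I) (('D_1 f x) ^+ 2)%:E)%E.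
  apply: ge0_subset_integral => //.
  - by apply/measurable_EFinP/measurable_funTS; exact: continuous_measurable_fun.
  - by move=> x _; rewrite lee_fin sqr_ge0.
  - move: Is It; rewrite /= !in_itv /= => /andP[? _] /andP[_ ?] x /=.
    rewrite !in_itv /= => /andP[? ?]; apply/andP; split; lra.
have Lr : (L <= 2 * r)%R.
  by move: Is It; rewrite /= !in_itv /= => /andP[? _] /andP[_ ?]; rewrite /L; lra.
have -> : ((f t - f s) ^+ 2)%:E = (L%:E * ((f t - f s) ^+ 2 / L)%:E)%E.
  by rewrite -EFinM; congr (_%:E); field; rewrite gt_eqF.
apply: (@le_trans _ _ (L%:E * \int[mu]_(x in I) (('D_1 f x) ^+ 2)%:E)%E).
  by apply: lee_wpmul2l; [rewrite lee_fin ltW|exact: le_trans le1 le2].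
apply: lee_wpmul2r; last by rewrite lee_fin.
by apply: integral_ge0 => x _; rewrite lee_fin sqr_ge0.
Qed.

(** F cannot stay above its average throughout the interval; the slack e makes the contradiction
    strict. *)
Lemma integral_pigeonhole (F : measurableTypeR R -> \bar R) (a e : R) :
  measurable_fun setT F -> (forall t, 0 <= F t)%E ->
  (\int[mu]_(t in I) F t = a%:E)%E -> 0 < e ->
  exists2 t, I t & (F t <= ((a + e) / (2 * r))%:E)%E.
Proof.
move=> mF F0 Fa e0; have mI : measurable I by exact: measurable_itv.
have r2 : 0 < 2 * r by rewrite mulr_gt0.
have a0 : 0 <= a by rewrite -lee_fin -Fa; apply: integral_ge0.
apply: contrapT => h.
suff : ((a + e)%:E <= a%:E)%E by rewrite lee_fin gerDl leNgt e0.
rewrite -Fa; apply: (@le_trans _ _ (\int[mu]_(t in I) ((a + e) / (2 * r))%:E)%E).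
  rewrite integral_cst// [X in (_ * X)%E]lebesgue_measure_I -EFinM divfK ?gt_eqF//.
apply: ge0_le_integral => //.
- by move=> t _; rewrite lee_fin divr_ge0 ?addr_ge0// ltW.
- exact: measurable_funTS.
move=> t It; rewrite leNgt; apply/negP => /ltW Ft.
by apply: h; exists t.
Qed.

(** Just the regularity that the induction over slices uses and preserves. *)
Definition C1 n (g : 'rV[R]_n -> R) := continuous g /\
  forall i, (forall x, derivable g x (dx i)) /\ continuous ('D_(dx i) g).

Lemma C1_slice n (g : 'rV[R]_n.+1 -> R) t : C1 g -> C1 (fun y => g (cons_rv t y)).
Proof.
move=> [cg dg]; split; first exact: continuous_sliceS.
move=> i; have [d c] := dg (lift ord0 i); split.
  by move=> y; apply: derivable_consS; exact: d.
rewrite (_ : 'D_(dx i) (fun y => g (cons_rv t y)) =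
    fun y => 'D_(dx (lift ord0 i)) g (cons_rv t y)).
  exact: (@continuous_sliceS R n ('D_(dx (lift ord0 i)) g) t c).
by apply/funext => y; rewrite derive_consS.
Qed.

Lemma sqgrad_cons n (g : 'rV[R]_n.+1 -> R) t y : sqgrad g (cons_rv t y) =
  'D_(dx ord0) g (cons_rv t y) ^+ 2 + sqgrad (fun z => g (cons_rv t z)) y.
Proof.
rewrite /sqgrad big_ord_recl; congr (_ + _).
by apply: eq_bigr => i _; rewrite derive_consS.
Qed.

Lemma C1_continuous_sqgrad n (g : 'rV[R]_n -> R) : C1 g -> continuous (sqgrad g).
Proof.
move=> [_ dg] x; rewrite /sqgrad.
apply: (@cvg_big _ _ _ _ _ _ _ (nbhs x)); first exact: add_continuous.
by move=> i _; have [_ c] := dg i; apply: (@cvgM _ _ (nbhs x)); exact: c.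
Qed.

Lemma sqgrad_ge0 n (g : 'rV[R]_n -> R) x : 0 <= sqgrad g x.
Proof. by apply: sumr_ge0 => i _; exact: sqr_ge0. Qed.

(** Induction on slices. By pigeonhole some slice t = t0 has at most the average energy, up to a
    slack; c is the constant that induction gives there. Then g(t,y) - c splits into g(t,y) -
    g(t0,y), controlled by the derivative in t, and g(t0,y) - c. Squaring this sum costs a factor 2
    per dimension, whence 2^n, and the slacks add up to e. *)
Lemma cube_poincare n (g : 'rV[R]_n -> R) (e : R) : C1 g -> 0 < e -> exists c : R,
  (\int[rvm n]_(x in @cube n) ((g x - c) ^+ 2)%:E <=
   (2 ^+ n * (2 * r) ^+ 2)%:E * \int[rvm n]_(x in @cube n) (sqgrad g x)%:E + e%:E)%E.
Proof.
elim: n g e => [|n IH] g e C1g e0.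
  exists (g 0); rewrite integral0_eq; last first.
    by move=> x _; rewrite (_ : x = 0) ?subrr ?expr0n//; apply/rowP => i; have := ltn_ord i.
  apply: adde_ge0; last by rewrite lee_fin ltW.
  apply: mule_ge0; first by rewrite lee_fin mulr_ge0 ?sqr_ge0.
  by apply: integral_ge0 => x _; rewrite lee_fin sqgrad_ge0.
have mI : measurable I by exact: measurable_itv.
have mQ m := @measurable_cube m.
set L : R := 2 * r; have L0 : 0 < L by rewrite mulr_gt0.
pose K : R := 2 ^+ n * L ^+ 2; have K0 : 0 < K by rewrite mulr_gt0 ?exprn_gt0.
have [cg dg] := C1g.
have cD0 := (dg ord0).2.
have csq : continuous (fun x => 'D_(dx ord0) g x ^+ 2).
  exact: (@continuousM_rv R n.+1 _ _ cD0 cD0).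
pose f0 (x : rVm R n.+1) : \bar R := ('D_(dx ord0) g x ^+ 2)%:E.
have mf0 : measurable_fun [set: rVm R n.+1] f0 by exact: measurable_EFin_rv.
have f00 x : (0 <= f0 x)%E by rewrite lee_fin sqr_ge0.
pose F t : \bar R := (\int[rvm n]_(y in @cube n) (sqgrad (fun z => g (cons_rv t z)) y)%:E)%E.
have mG : measurable_fun [set: rVm R n.+1] (fun x => (sqgrad g x)%:E).
  by apply: measurable_EFin_rv; exact: C1_continuous_sqgrad.
have cT : continuous (fun x : 'rV[R]_n.+1 => sqgrad g x - 'D_(dx ord0) g x ^+ 2).
  by move=> x; apply: (@cvgB _ _ _ (nbhs x)); [exact: C1_continuous_sqgrad|exact: csq].
have TE t y : sqgrad g (cons_rv t y) - 'D_(dx ord0) g (cons_rv t y) ^+ 2 =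
    sqgrad (fun z => g (cons_rv t z)) y by rewrite sqgrad_cons addrAC subrr add0r.
have T0 x : (0 <= (sqgrad g x - 'D_(dx ord0) g x ^+ 2)%:E)%E.
  by rewrite -(cons_head_tail x) TE lee_fin sqgrad_ge0.
have FE t : F t = (\int[rvm n]_(y in @cube n)
    (sqgrad g (cons_rv t y) - 'D_(dx ord0) g (cons_rv t y) ^+ 2)%:E)%E.
  by apply: eq_integral => y _; rewrite TE.
have mF : measurable_fun [set: measurableTypeR R] F.
  rewrite (_ : F = fun t => (\int[rvm n]_(y in @cube n)
    (sqgrad g (cons_rv t y) - 'D_(dx ord0) g (cons_rv t y) ^+ 2)%:E)%E); last exact/funext.
  exact: (measurable_cube_slice0 (measurable_EFin_rv cT) T0).
have F0 t : (0 <= F t)%E by apply: integral_ge0 => y _; rewrite lee_fin sqgrad_ge0.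
have SE : (\int[rvm n.+1]_(x in @cube n.+1) (sqgrad g x)%:E =
    \int[rvm n.+1]_(x in @cube n.+1) f0 x + \int[mu]_(t in I) F t)%E.
  have -> : (\int[mu]_(t in I) F t = \int[rvm n.+1]_(x in @cube n.+1)
      (sqgrad g x - 'D_(dx ord0) g x ^+ 2)%:E)%E.
    by rewrite (cube_integral0 (measurable_EFin_rv cT) T0); apply: eq_integral.
  rewrite -ge0_integralD//.
  - by apply: eq_integral => x _; rewrite /f0 -EFinD addrC subrK.
  - exact: measurable_funTS.
  - by apply: measurable_funTS; exact: measurable_EFin_rv.
rewrite SE.
have dd0 : (0 <= \int[rvm n.+1]_(x in @cube n.+1) f0 x)%E by apply: integral_ge0.
have aa0 : (0 <= \int[mu]_(t in I) F t)%E by apply: integral_ge0.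
have K2 : 2 ^+ n.+1 * L ^+ 2 = 2 * K by rewrite exprS -mulrA.
rewrite K2.
(* If either part of the energy is infinite, the right side is infinite and any c will do. *)
have [Doo|Dfin] := eqVneq (\int[rvm n.+1]_(x in @cube n.+1) f0 x)%E +oo%E.
  exists 0; rewrite Doo addye; last by rewrite gt_eqF// (lt_le_trans _ aa0).
  by rewrite gt0_muley ?lte_fin ?mulr_gt0// addye// leey.
have [Aoo|Afin] := eqVneq (\int[mu]_(t in I) F t)%E +oo%E.
  exists 0; rewrite Aoo addey; last by rewrite gt_eqF// (lt_le_trans _ dd0).
  by rewrite gt0_muley ?lte_fin ?mulr_gt0// addye// leey.
have [dd DE] : exists dd : R, (\int[rvm n.+1]_(x in @cube n.+1) f0 x = dd%:E)%E.
  by exists (fine (\int[rvm n.+1]_(x in @cube n.+1) f0 x)%E); rewrite fineK// ge0_fin_numE// ltey.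
have [aa AE] : exists aa : R, (\int[mu]_(t in I) F t = aa%:E)%E.
  by exists (fine (\int[mu]_(t in I) F t)%E); rewrite fineK// ge0_fin_numE// ltey.
(* The slacks e/(4K) here and e/(4L) for the induction hypothesis each contribute e/(4L) to p;
   integrating 2p over a length L then costs exactly e. *)
have [t0 It0 Ft0] := integral_pigeonhole mF F0 AE (divr_gt0 e0 (mulr_gt0 (ltr0n _ 4) K0)).
have [c Hc] := IH _ _ (C1_slice t0 C1g) (divr_gt0 e0 (mulr_gt0 (ltr0n _ 4) L0)).
exists c.
set P := (\int[rvm n]_(y in @cube n) ((g (cons_rv t0 y) - c) ^+ 2)%:E)%E in Hc.
set p : R := K * ((aa + e / (4%:R * K)) / L) + e / (4%:R * L).
have Pp : (P <= p%:E)%E.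
  apply: (le_trans Hc); rewrite /p EFinD; apply: leeD2r; rewrite [leRHS]EFinM.
  by apply: (lee_wpmul2l _ Ft0); rewrite lee_fin ltW.
have mc (h : 'rV[R]_n.+1 -> R) : continuous h ->
    measurable_fun [set: rVm R n.+1] (fun x => ((h x - c) ^+ 2)%:E).
  move=> ch; apply: measurable_EFin_rv.
  have ch' : continuous (fun x => h x - c).
    by move=> x; apply: (@cvgB _ _ _ (nbhs x)); [exact: ch|exact: cvg_cst].
  exact: (@continuousM_rv R n.+1 _ _ ch' ch').
have mP : measurable_fun [set: rVm R n] (fun y => ((g (cons_rv t0 y) - c) ^+ 2)%:E).
  exact: (measurable_comp measurableT _ (mc g cg) (measurable_cons_rvr t0)).
rewrite (cube_integral0 (mc g cg)); last by move=> x; rewrite lee_fin sqr_ge0.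
apply: (@le_trans _ _ (\int[mu]_(t in I) (2 * L * dd + 2 * p)%:E)%E); last first.
  have -> : (\int[mu]_(t in I) (2 * L * dd + 2 * p)%:E = ((2 * L * dd + 2 * p) * L)%:E)%E.
    by rewrite integral_cst// EFinM; congr (_ * _)%E; exact: lebesgue_measure_I.
  rewrite DE AE.
  have -> : ((2 * K)%:E * (dd%:E + aa%:E) + e%:E = (2 * K * (dd + aa) + e)%:E)%E by [].
  rewrite lee_fin.
  have dd0' : 0 <= dd by rewrite -lee_fin -DE.
  have -> : (2 * L * dd + 2 * p) * L = 2 * L ^+ 2 * dd + 2 * K * aa + e.
    by rewrite /p; field; rewrite !gt_eqF.
  have LK : L ^+ 2 <= K by rewrite /K ler_peMl ?sqr_ge0// exprn_ege1// ler1n.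
  rewrite mulrDr lerD2r lerD2r -!(mulrA 2) ler_pM2l//; exact: ler_wpM2r.
apply: ge0_le_integral => //.
- by move=> t _; apply: integral_ge0 => y _; rewrite lee_fin sqr_ge0.
- apply: measurable_funTS; apply: (measurable_cube_slice0 (mc g cg)).
  by move=> x; rewrite lee_fin sqr_ge0.
move=> t It.
have EE : (\int[rvm n]_(y in @cube n) \int[mu]_(s in I) f0 (cons_rv s y) = dd%:E)%E.
  by rewrite -(cube_integralS mf0 f00).
apply: (@le_trans _ _ (\int[rvm n]_(y in @cube n) ((2 * L)%:E *
    \int[mu]_(s in I) f0 (cons_rv s y) + 2%:E * ((g (cons_rv t0 y) - c) ^+ 2)%:E))%E).
  apply: ge0_le_integral => //.
  - by move=> y _; rewrite lee_fin sqr_ge0.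
  - apply: measurable_funTS.
    exact: (measurable_comp measurableT _ (mc g cg) (measurable_cons_rvr t)).
  - apply: measurable_funTS; apply: emeasurable_funD.
      by apply: measurable_funeM; exact: measurable_cube_sliceS.
    exact: measurable_funeM.
  move=> y _.
  have : (((g (cons_rv t y) - g (cons_rv t0 y)) ^+ 2)%:E <= L%:E *
      \int[mu]_(s in I) f0 (cons_rv s y))%E.
    have d1 s : derivable (fun s : R => g (cons_rv s y)) s 1.
      by apply: derivable_cons0; exact: (dg ord0).1.
    have c1 : continuous ('D_1 (fun s : R => g (cons_rv s y))).
      rewrite (_ : 'D_1 (fun s : R => g (cons_rv s y)) =
        (fun s => 'D_(dx ord0) g (cons_rv s y))).
        exact: (@continuous_slice0 R n ('D_(dx ord0) g) y cD0).
      by apply/funext => s; rewrite derive_cons0.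
    have -> : (\int[mu]_(s in I) f0 (cons_rv s y) =
        \int[mu]_(s in I) (('D_1 (fun s : R => g (cons_rv s y)) s) ^+ 2)%:E)%E.
      by apply: eq_integral => s _; rewrite /f0 derive_cons0.
    exact: (sqr_increment_le d1 c1 It0 It).
  move=> h; apply: (@le_trans _ _ (2%:E * ((g (cons_rv t y) - g (cons_rv t0 y)) ^+ 2)%:E +
    2%:E * ((g (cons_rv t0 y) - c) ^+ 2)%:E)%E).
    set u := g (cons_rv t y); set v := g (cons_rv t0 y).
    have -> : (2%:E * ((u - v) ^+ 2)%:E + 2%:E * ((v - c) ^+ 2)%:E =
      (2 * (u - v) ^+ 2 + 2 * (v - c) ^+ 2)%:E)%E by [].
    rewrite lee_fin -subr_ge0.
    have -> : 2 * (u - v) ^+ 2 + 2 * (v - c) ^+ 2 - (u - c) ^+ 2 =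
      (u - v - (v - c)) ^+ 2 by ring.
    exact: sqr_ge0.
  apply: leeD2r; rewrite [(2 * L)%:E]EFinM -muleA; apply: lee_wpmul2l => //.
rewrite ge0_integralD//; last 4 first.
- move=> y _; apply: mule_ge0; first by rewrite lee_fin mulr_ge0// ltW.
  by apply: integral_ge0 => s _; exact: f00.
- by apply: measurable_funTS; apply: measurable_funeM; exact: measurable_cube_sliceS.
- by move=> y _; rewrite -EFinM lee_fin mulr_ge0// sqr_ge0.
- by apply: measurable_funTS; exact: measurable_funeM.
rewrite ge0_integralZl//; last 3 first.
- by apply: measurable_funTS; exact: measurable_cube_sliceS.
- by move=> y _; apply: integral_ge0 => s _; exact: f00.
- by rewrite lee_fin mulr_ge0// ltW.
rewrite ge0_integralZl//; last 2 first.
- exact: measurable_funTS.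
- by move=> y _; rewrite lee_fin sqr_ge0.
rewrite EE.
have -> : ((2 * L * dd + 2 * p)%:E = (2 * L)%:E * dd%:E + 2%:E * p%:E)%E by [].
by apply: leeD2l; apply: lee_wpmul2l.
Qed.

End cube.

Lemma powR_invl (R : realType) (x p : R) : 0 <= x -> x^-1 `^ p = x `^ (- p).
Proof. by move=> x0; rewrite -(powR_inv1 x0) -powRrM mulN1r. Qed.

(** * The case A > 0: the sharp constant and its optimality *)

Section hardy_constant.
Variables (R : realType) (n : nat) (D k a : R).
Hypotheses (D0 : 0 < D) (k0 : 0 < k).
Local Notation dx i := (delta_mx 0 i).
Local Notation W := (@weight R n D k).

Lemma dominated_sqgrad_weight (g : 'rV[R]_n -> R) p : smooth g -> bounded_support g ->
  dominated (fun x => sqgrad g x * W x `^ p).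
Proof.
move=> sg bg; apply: bounded_support_dominated.
  by apply: continuousM_rv; [exact: continuous_sqgrad|exact: continuous_weight_powR].
exact/bounded_supportMr/bounded_support_sqgrad.
Qed.

Lemma dominated_sqr_weight (g : 'rV[R]_n -> R) p : smooth g -> bounded_support g ->
  dominated (fun x => g x ^+ 2 * W x `^ p).
Proof.
move=> sg bg; have cg := smooth_continuous sg.
apply: bounded_support_dominated.
  by apply: continuousM_rv; [exact: continuousM_rv|exact: continuous_weight_powR].
by apply: bounded_supportMr; have [B gB] := bg; exists B => x Bx; rewrite gB// expr0n.
Qed.

(** The multiple k A^2 / 4 of W has the same |x|^2 coefficient, lam^2, as the Hardy weight. The D
    coefficients compare because A / 2 = n/2 + a - 1 is at most n. *)
Lemma hardy_upper (g : 'rV[R]_n -> R) : 0 < n%:R + 2 * a - 2 -> a <= 1 ->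
  smooth g -> bounded_support g ->
  \int[rvm n]_x (g x ^+ 2 * W x `^ (a - 1)) <=
  4 / (k * (n%:R + 2 * a - 2) ^+ 2) * \int[rvm n]_x (sqgrad g x * W x `^ a).
Proof.
set A := n%:R + 2 * a - 2 => A0 a1 sg bg.
rewrite -ler_pdivrMl; last by rewrite divr_gt0// mulr_gt0// exprn_gt0.
apply: le_trans (@hardy_weight R n D k a D0 k0 g sg bg).
rewrite -dominated_RintegralZ; last exact: dominated_sqr_weight.
apply: dominated_le_Rintegral.
- by apply: dominatedZ; exact: dominated_sqr_weight.
- apply: bounded_support_dominated; last first.
    by apply: bounded_supportMr; have [B gB] := bg; exists B => x Bx; rewrite gB// expr0n.
  have cg := smooth_continuous sg.
  apply: continuousM_rv; first exact: continuousM_rv.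
  apply: continuousM_rv; first exact: continuous_weight_powR.
  move=> x; apply: (@cvgD _ _ _ (nbhs x)); first exact: cvg_cst.
  by apply: (@cvgM _ _ (nbhs x)); [exact: cvg_cst|exact: continuous_sqnorm].
move=> x; rewrite mulrCA; apply: ler_wpM2l; first exact: sqr_ge0.
have -> : a - 1 = a - 2 + 1 by ring.
rewrite gt0_powRD ?weight_gt0// powRr1 ?(ltW (weight_gt0 D0 k0 x))// mulrCA.
apply: ler_wpM2l; first exact: powR_ge0.
have N0 := sqnorm_ge0 x; have n0 : 0 <= n%:R :> R by [].
rewrite -/A /weight invf_div mulrDr; apply: lerD; last first.
  by rewrite le_eqVlt; apply/orP; left; apply/eqP; field.
apply: ler_wpM2r; first exact: ltW.
have -> : k * A ^+ 2 / 4 = A * k / 2 * (A / 2) by field.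
apply: ler_wpM2l; first by rewrite divr_ge0// mulr_ge0// ltW.
rewrite /A; lra.
Qed.

Lemma Rintegral_weight_gt0 p : 0 <= p -> n%:R / 2 < p ->
  0 < \int[rvm n]_x (W x `^ (- p)).
Proof.
move=> p0 np; have dom := dominated_weight_powR D0 k0 np.
pose wm : R := D + k * n%:R.
have wm0 : 0 < wm by rewrite ltr_wpDr// mulr_ge0// ltW.
rewrite -lte_fin /Rintegral fineK; last exact: (integrable_fin_num _ (dominated_integrable dom)).
have mQ := @measurable_cube R 1 n.
have mW : measurable_fun [set: rVm R n] (fun x => (W x `^ (- p))%:E).
  by apply: measurable_EFin_rv; exact: continuous_weight_powR.
apply: (@lt_le_trans _ _ (\int[rvm n]_(x in @cube R 1 n) (wm `^ (- p))%:E)%E).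
  rewrite integral_cst// [X in (_ * X)%E](cube_volume (@ltr01 R)) -EFinM lte_fin.
  by rewrite mulr_gt0 ?powR_gt0// exprn_gt0.
apply: (@le_trans _ _ (\int[rvm n]_(x in @cube R 1 n) (W x `^ (- p))%:E)%E).
  apply: ge0_le_integral => //.
  - by move=> x _; rewrite lee_fin powR_ge0.
  - exact: measurable_funTS.
  move=> x xQ; rewrite lee_fin; apply: ler_powRN => //; first exact: weight_gt0.
  rewrite /weight lerD2l ler_pM2l// /sqnorm (@le_trans _ _ (\sum_(i < n) 1))//; last first.
    by rewrite sumr_const card_ord.
  apply: ler_sum => i _; rewrite -real_normK ?num_real//.
  by rewrite exprn_ile1// xQ.
apply: ge0_subset_integral => //.
by move=> x _; rewrite lee_fin powR_ge0.
Qed.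

Lemma is_derive_powR_cutoff (s rho w : R) : 0 < w ->
  is_derive w 1 (fun w => w `^ (- s) * cutoff rho w)
    (w `^ (- s - 1) * (- s * cutoff rho w + dcutoff rho w * w)).
Proof.
move=> w0.
have dp := is_derive1_powR (- s) w0; have dc := is_derive_cutoff rho w.
have -> : (fun w => w `^ (- s) * cutoff rho w) = (@powR R ^~ (- s)) * cutoff rho by [].
apply: is_derive_eq; rewrite /GRing.scale /=.
have -> : w `^ (- s) = w `^ (- s - 1) * w.
  by rewrite -{3}(powRr1 (ltW w0)) -gt0_powRD// subrK.
by ring.
Qed.

(* Near-optimisers: W^-s cut off at W = rho, with s slightly above the critical
   exponent (n + 2 a - 2) / 4. *)
Lemma hardy_optimal (C : R) (s0 := (n%:R + 2 * a - 2) / 4) : 0 < s0 -> 0 <= C ->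
  C * (4 * k * s0 ^+ 2) < 1 ->
  exists g : 'rV[R]_n -> R, [/\ smooth g, bounded_support g &
    C * \int[rvm n]_x (sqgrad g x * W x `^ a) <
    \int[rvm n]_x (g x ^+ 2 * W x `^ (a - 1))].
Proof.
move=> s00 C0 Cs.
have [s s0s Cs1] : exists2 s, s0 < s & C * (4 * k * s ^+ 2) < 1.
  set u := C * (4 * k * s0 ^+ 2) in Cs.
  have u0 : 0 <= u by rewrite mulr_ge0// mulr_ge0 ?sqr_ge0// mulr_ge0// ltW.
  (* Then u = 1 - 4v, and (1 - 4v)(1 + v)^2 < 1 leaves room to enlarge s0 by the factor 1 + v. *)
  pose v := (1 - u) / 4; have v0 : 0 < v by rewrite divr_gt0// subr_gt0.
  exists (s0 * (1 + v)); first by rewrite ltr_pMr// ltrDl.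
  have -> : C * (4 * k * (s0 * (1 + v)) ^+ 2) = u * (1 + v) ^+ 2 by rewrite /u; ring.
  have -> : u = 1 - 4 * v by rewrite /v; field.
  have v1 : v <= 4^-1 by rewrite /v ler_pdivrMr// mulVf//; lra.
  by nra.
have sp : 0 < s by exact: lt_trans s00 s0s.
(* With p as below, p - n/2 = 2 (s - s0), so W^-(p-e) remains integrable. *)
pose e := Num.min 1 (s - s0).
have e0 : 0 < e by rewrite lt_min ltr01 subr_gt0.
have e1 : e <= 1 by rewrite ge_min lexx.
have es : e <= s - s0 by rewrite ge_min lexx orbT.
(* Without cutoff, the square of W^-s times W^(a-1) is W^-p. *)
pose p := 2 * s + 1 - a.
have pe : n%:R / 2 < p - e by rewrite /p; move: es e0; rewrite /s0; lra.
have pp : n%:R / 2 < p by lra.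
have n2 : 0 <= n%:R / 2 :> R by rewrite divr_ge0.
pose K : R := 4 * expR 1; have K0 : 0 < K by rewrite mulr_gt0 ?expR_gt0.
pose c1 := 4 * k * (2 * s * K + K ^+ 2).
have c10 : 0 <= c1.
  apply: mulr_ge0; first by rewrite mulr_ge0// ltW.
  by rewrite addr_ge0 ?sqr_ge0// !mulr_ge0 ?(ltW sp) ?(ltW K0).
pose Ip := \int[rvm n]_x (W x `^ (- p)).
pose Ie := \int[rvm n]_x (W x `^ (- (p - e))).
have Ip0 : 0 < Ip by apply: Rintegral_weight_gt0 => //; lra.
have Ie0 : 0 < Ie by apply: Rintegral_weight_gt0 => //; lra.
(* The cutoff costs at most (C c1 + 4) y Ie in total; this y makes it half of the gap (1 - 4 C k
   s^2) Ip. *)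
pose y := (1 - C * (4 * k * s ^+ 2)) * Ip / (2 * ((C * c1 + 4) * Ie)).
have q0 : 0 < (C * c1 + 4) * Ie by rewrite mulr_gt0// ltr_wpDl// mulr_ge0.
have y0 : 0 < y by rewrite divr_gt0// mulr_gt0// subr_gt0.
pose rho := y `^ (- e^-1); have r0 : 0 < rho by rewrite powR_gt0.
have rhoE : rho `^ (- e) = y.
  by rewrite /rho -powRrM mulrNN mulVf ?gt_eqF// powRr1 ?ltW.
pose f (w : R) := w `^ (- s) * cutoff rho w.
pose g (x : 'rV[R]_n) := f (W x).
have sg : smooth g.
  apply: smexprW; apply: smexpr_mul; last exact: smexpr_cutoff.
  by apply: smexpr_powR; [exact: weight_gt0|exact: smexpr_weight].
have bg : bounded_support g.
  have [B hB] := bounded_support_cutoff n D0 k0 r0.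
  by exists B => x Bx; rewrite /g /f hB// mulr0.
have domp := dominated_weight_powR D0 k0 pp.
have dome := dominated_weight_powR D0 k0 pe.
have thE x : (W x / rho) `^ e = y * W x `^ e.
  have W0 := weight_gt0 D0 k0 x.
  rewrite powRM ?invr_ge0 ?(ltW W0) ?(ltW r0)// mulrC -rhoE.
  by rewrite (powR_invl _ (ltW r0)).
have peE x : W x `^ (- p) * W x `^ e = W x `^ (- (p - e)).
  by rewrite -gt0_powRD ?weight_gt0//; congr (_ `^ _); ring.
have upN x : sqgrad g x * W x `^ a <=
    4 * k * s ^+ 2 * W x `^ (- p) + c1 * y * W x `^ (- (p - e)).
  have W0 := weight_gt0 D0 k0 x.
  have h1 := sqgrad_weight_comp D0 k0 (is_derive_powR_cutoff s rho W0).
  apply: (@le_trans _ _ _ _ _ (ler_wpM2r (powR_ge0 (W x) a) h1)).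
  set ch := cutoff rho (W x); set d := dcutoff rho (W x) * W x.
  have -> : 4 * k * (W x `^ (- s - 1) * (- s * ch + d)) ^+ 2 * W x * W x `^ a =
      4 * k * W x `^ (- p) * (- s * ch + d) ^+ 2.
    have -> : W x `^ (- p) = W x `^ (- s - 1) * W x `^ (- s - 1) * (W x * W x `^ a).
      rewrite -[X in _ * (X * _)](powRr1 (ltW W0)) -!gt0_powRD//; congr (_ `^ _).
      by rewrite /p; ring.
    by ring.
  rewrite -peE.
  have [d1 d2] := dcutoff_powR_le r0 W0 (ltW e0) e1.
  rewrite thE -/d -/K in d1 d2.
  have ch0 : 0 <= ch by exact: cutoff_ge0.
  have ch1 : ch <= 1 by apply: cutoff_le1 => //; exact: ltW.
  set th := y * W x `^ e in d1 d2.
  have -> : 4 * k * s ^+ 2 * W x `^ (- p) + c1 * y * (W x `^ (- p) * W x `^ e) =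
     4 * k * W x `^ (- p) * (s ^+ 2 + (2 * s * K + K ^+ 2) * th).
    by rewrite /c1 /th; ring.
  apply: ler_wpM2l; first by rewrite mulr_ge0 ?powR_ge0// mulr_ge0// ltW.
  have hd : - (ch * d) <= K * th.
    rewrite -mulrN; apply: (@le_trans _ _ (ch * `|d|)).
      by apply: ler_wpM2l => //; rewrite -normrN; exact: ler_norm.
    by apply: le_trans d1; rewrite ler_piMl.
  have := ler_wpM2l (mulr_ge0 (ler0n R 2) (ltW sp)) hd.
  have : (s * ch) ^+ 2 <= s ^+ 2.
    by rewrite exprMn ler_piMr ?sqr_ge0// exprn_ile1.
  by lra.
have loG x : W x `^ (- p) - 4 * y * W x `^ (- (p - e)) <= g x ^+ 2 * W x `^ (a - 1).
  have W0 := weight_gt0 D0 k0 x.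
  have -> : g x ^+ 2 * W x `^ (a - 1) = W x `^ (- p) * cutoff rho (W x) ^+ 2.
    have -> : W x `^ (- p) = W x `^ (- s) * W x `^ (- s) * W x `^ (a - 1).
      by rewrite -!gt0_powRD//; congr (_ `^ _); rewrite /p; ring.
    by rewrite /g /f; ring.
  have := cutoff_tail r0 W0 (ltW e0) e1; rewrite thE -peE => h.
  have := ler_wpM2l (powR_ge0 (W x) (- p)) h.
  by lra.
have domN := dominated_sqgrad_weight a sg bg.
have domG := dominated_sqr_weight (a - 1) sg bg.
exists g; split => //.
have N1 : \int[rvm n]_x (sqgrad g x * W x `^ a) <= 4 * k * s ^+ 2 * Ip + c1 * y * Ie.
  rewrite /Ip /Ie -!dominated_RintegralZ// -dominated_RintegralD; [|exact: dominatedZ..].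
  by apply: dominated_le_Rintegral => //; apply: dominatedD; exact: dominatedZ.
have G1 : Ip - 4 * y * Ie <= \int[rvm n]_x (g x ^+ 2 * W x `^ (a - 1)).
  rewrite /Ip /Ie -mulNr -dominated_RintegralZ// -dominated_RintegralD//; last exact: dominatedZ.
  apply: dominated_le_Rintegral => //; first by apply: dominatedD => //; exact: dominatedZ.
  by move=> x; rewrite mulNr; exact: loG.
apply: le_lt_trans (ler_wpM2l C0 N1) _; apply: lt_le_trans G1.
have yE : y * ((C * c1 + 4) * Ie) = (1 - C * (4 * k * s ^+ 2)) * Ip / 2.
  have Qn0 : (C * c1 + 4) * Ie != 0 by rewrite gt_eqF.
  by rewrite /y; move: ((C * c1 + 4) * Ie) Qn0 => Q Qn0; field.
have : 0 < (1 - C * (4 * k * s ^+ 2)) * Ip by rewrite mulr_gt0// subr_gt0.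
have -> : C * (4 * k * s ^+ 2 * Ip + c1 * y * Ie) =
  Ip - (1 - C * (4 * k * s ^+ 2)) * Ip + y * ((C * c1 + 4) * Ie) - 4 * y * Ie by ring.
by rewrite yE; lra.
Qed.

End hardy_constant.

(** * The case A < 0: Hardy outside a cube, Poincare inside, uniformly in D *)

Section poincare.
Variables (R : realType) (n : nat) (k a : R).
Hypotheses (k0 : 0 < k) (a0 : a < 0) (A0 : n%:R + 2 * a - 2 < 0).
Local Notation dx i := (delta_mx 0 i).

Section fixed_D.
Variable D : R.
Hypothesis D0 : 0 < D.
Local Notation W := (@weight R n D k).

Lemma dominated_bounded_weight (f : 'rV[R]_n -> R) (M p : R) : continuous f ->
  (forall x, `|f x| <= M) -> n%:R / 2 < p -> dominated (fun x => f x * W x `^ (- p)).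
Proof.
move=> cf fM np; have dom := dominated_weight_powR D0 k0 np.
apply: (dominated_le _ (dominatedZ M dom)).
  by apply: continuousM_rv => //; exact: continuous_weight_powR.
by move=> x; rewrite normrM [X in _ * X]ger0_norm ?powR_ge0// ler_wpM2r ?powR_ge0.
Qed.

Lemma mean_deviation_le (g : 'rV[R]_n -> R) (c : R) : smooth g -> bounded_support g ->
  \int[rvm n]_x ((g x - (\int[rvm n]_x (g x * W x `^ (a - 1))) /
                        (\int[rvm n]_x (W x `^ (a - 1)))) ^+ 2 * W x `^ (a - 1)) <=
  \int[rvm n]_x ((g x - c) ^+ 2 * W x `^ (a - 1)).
Proof.
move=> sg bg; have np : n%:R / 2 < 1 - a by move: A0; lra.
have E : a - 1 = - (1 - a) by ring.
have dw := dominated_weight_powR D0 k0 np; rewrite -E in dw.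
have J0 : 0 < \int[rvm n]_x (W x `^ (a - 1)).
  by rewrite E; apply: Rintegral_weight_gt0 => //; move: a0; lra.
have cg := smooth_continuous sg.
have [M gM] := bounded_support_norm_le cg bg.
have dg := dominated_bounded_weight cg gM np; rewrite -E in dg.
have dg2 := dominated_sqr_weight D0 k0 (a - 1) sg bg.
have exp b : \int[rvm n]_x ((g x - b) ^+ 2 * W x `^ (a - 1)) =
    \int[rvm n]_x (g x ^+ 2 * W x `^ (a - 1)) +
    (- (2 * b) * \int[rvm n]_x (g x * W x `^ (a - 1)) +
     b ^+ 2 * \int[rvm n]_x (W x `^ (a - 1))).
  rewrite -!dominated_RintegralZ// -dominated_RintegralD; [|exact: dominatedZ..].
  rewrite -dominated_RintegralD//; last by apply: dominatedD; exact: dominatedZ.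
  by apply: eq_Rintegral => x _; ring.
rewrite !exp lerD2l; set J1 := \int[rvm n]_x (g x * _); set J := \int[rvm n]_x _ in J0 *.
rewrite -subr_ge0.
have -> : - (2 * c) * J1 + c ^+ 2 * J - (- (2 * (J1 / J)) * J1 + (J1 / J) ^+ 2 * J) =
  (c * J - J1) ^+ 2 / J by field; rewrite gt_eqF.
by rewrite divr_ge0 ?sqr_ge0// ltW.
Qed.

Lemma integrable_cube_bounded (r : R) (f : 'rV[R]_n -> R) (M : R) : 0 < r ->
  continuous f -> (forall x, `|f x| <= M) ->
  (rvm n).-integrable setT (EFin \o ((f : rVm R n -> R) \_ (@cube R r n))).
Proof.
move=> r0 cf fM; have mQ := @measurable_cube R r n.
have M0 : 0 <= M by exact: le_trans (normr_ge0 _) (fM 0).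
have : (rvm n).-integrable (@cube R r n) (EFin \o (f : rVm R n -> R)).
  apply: (@le_integrable _ _ _ _ _ _ _ (cst M%:E)) => //.
  - by apply: measurable_funTS; exact: measurable_EFin_rv.
  - by move=> x _ /=; rewrite lee_fin (le_trans (fM x))// ler_norm.
  apply/integrableP; split; first exact: measurable_cst.
  rewrite (_ : (fun x => _) = cst `|M%:E|%E)// integral_cst//.
  by rewrite [X in (_ * X)%E](cube_volume r0) -EFinM ltry.
by move/(integrable_mkcond _ mQ); rewrite restrict_EFin.
Qed.

(** With th k = lam^2 / 2, only half of the |x|^2 term is spent on th W^(a-1). What remains is
    W^(a-2) (lam^2 |x|^2 / 2 - b D): nonnegative once |x| >= r, and never below -b D^(a-1), because
    W >= D. *)
Lemma hardy_weight_ge (x : 'rV[R]_n) (r : R)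
    (lam := (n%:R + 2 * a - 2) * k / 2) (th := lam ^+ 2 / (2 * k))
    (b := th - lam * n%:R) (w := W x `^ (a - 2) * (lam * n%:R * D + lam ^+ 2 * sqnorm x)) :
  0 < r -> r ^+ 2 = 2 * b / lam ^+ 2 * D ->
  th * W x `^ (a - 1) <= w + b * D `^ (a - 1) /\
  (~ @cube R r n x -> th * W x `^ (a - 1) <= w).
Proof.
move=> r0 rE.
have lam0 : lam < 0 by rewrite /lam pmulr_llt0 ?invr_gt0// pmulr_llt0.
have lam2 : 0 < lam ^+ 2 by rewrite -sqrrN exprn_gt0// oppr_gt0.
have th0 : 0 < th by rewrite divr_gt0// mulr_gt0.
have b0 : 0 < b by rewrite ltr_pwDl// oppr_ge0 nmulr_rle0.
have W0 := weight_gt0 D0 k0 x; have N0 := sqnorm_ge0 x.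
rewrite /w; set P := W x `^ (a - 2).
have P0 : 0 < P by rewrite powR_gt0.
have -> : W x `^ (a - 1) = P * W x.
  by rewrite (_ : a - 1 = a - 2 + 1); [rewrite gt0_powRD// powRr1 ?ltW|ring].
have thk : th * k = lam ^+ 2 / 2 by rewrite /th; field; rewrite gt_eqF.
have lb : lam * n%:R * D + lam ^+ 2 * sqnorm x =
    th * W x + (lam ^+ 2 / 2 * sqnorm x - b * D).
  by rewrite [W x]/(D + k * sqnorm x) mulrDr (mulrA th k) thk /b; field.
have -> : th * (P * W x) = P * (th * W x) by ring.
rewrite lb; move: (th * W x) => tW; rewrite mulrDr; split => [|xQ].
  rewrite -addrA lerDl mulrBr -addrA addr_ge0//.
    by rewrite mulr_ge0 ?(ltW P0)// mulr_ge0// divr_ge0// ltW.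
  rewrite addrC subr_ge0 mulrCA ler_pM2l//.
  rewrite (_ : a - 1 = a - 2 + 1); last by ring.
  rewrite gt0_powRD// powRr1 ?(ltW D0)// ler_wpM2r ?(ltW D0)//.
  rewrite /P (_ : a - 2 = - (2 - a)); last by ring.
  apply: ler_powRN => //; [by move: a0; lra|exact: weight_ge].
rewrite lerDl mulr_ge0 ?(ltW P0)// subr_ge0.
have [i xi] : exists i, r < `|x ord0 i|.
  apply: contrapT => /forallNP hx; apply: xQ => i.
  by rewrite leNgt; apply/negP/hx.
have hr : r ^+ 2 <= sqnorm x.
  apply: le_trans (coord_sqr_le x i); rewrite -[leRHS]real_normK ?num_real//.
  by rewrite lerXn2r ?nnegrE ?(ltW r0) ?(ltW xi)// normr_ge0.
rewrite rE in hr.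
have -> : b * D = lam ^+ 2 / 2 * (2 * b / lam ^+ 2 * D) by field; rewrite lt_eqF.
by rewrite ler_wpM2l// divr_ge0// ltW.
Qed.

(** The last bookkeeping of [poincare_cutoff], with the integrals abstracted to variables. *)
Lemma le_absorb (I0 I1 I2 I3 G X t e1 e2 : R) : t * I1 <= I2 + X -> I2 <= I3 ->
  I3 <= 2 * G + e1 -> t * (I0 - e2) <= t * I1 ->
  t * I0 <= 2 * G + X + (e1 + t * e2).
Proof. by lra. Qed.

(** [hardy_weight] wants bounded support, which g - c need not have. It is applied to the product of
    g - c with a cutoff; the square of the gradient of this product accounts for the factor 2. *)
Lemma poincare_cutoff (g : 'rV[R]_n -> R) (c r : R)
    (lam := (n%:R + 2 * a - 2) * k / 2) (th := lam ^+ 2 / (2 * k))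
    (b := th - lam * n%:R) :
  smooth g -> bounded_support g -> 0 < r -> r ^+ 2 = 2 * b / lam ^+ 2 * D ->
  th * \int[rvm n]_x ((g x - c) ^+ 2 * W x `^ (a - 1)) <=
  2 * \int[rvm n]_x (sqgrad g x * W x `^ a) +
  b * D `^ (a - 1) * \int[rvm n]_(x in @cube R r n) ((g x - c) ^+ 2).
Proof.
move=> sg bg r0 rE.
have lam0 : lam < 0 by rewrite /lam pmulr_llt0 ?invr_gt0// pmulr_llt0.
have lam2 : 0 < lam ^+ 2 by rewrite -sqrrN exprn_gt0// oppr_gt0.
have th0 : 0 < th by rewrite divr_gt0// mulr_gt0.
have n0 : 0 <= n%:R :> R by [].
have b0 : 0 < b by rewrite ltr_pwDl// oppr_ge0 nmulr_rle0.
have cg := smooth_continuous sg.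
have [M0 gM0] := bounded_support_norm_le cg bg.
pose M := M0 + `|c|.
have gM x : `|g x - c| <= M by rewrite (le_trans (ler_normB _ _))// lerD2r.
have Mp : 0 <= M by exact: le_trans (normr_ge0 _) (gM 0).
have gM2 x : (g x - c) ^+ 2 <= M ^+ 2.
  by rewrite -real_normK ?num_real// lerXn2r ?nnegrE.
have cgc : continuous (fun x => (g x - c) ^+ 2).
  have c1 : continuous (fun x => g x - c).
    by move=> x; apply: (@cvgB _ _ _ (nbhs x)); [exact: cg|exact: cvg_cst].
  exact: (@continuousM_rv R n _ _ c1 c1).
have gM2' x : `|(g x - c) ^+ 2| <= M ^+ 2 by rewrite ger0_norm ?sqr_ge0.
have np : n%:R / 2 < 1 - a by move: A0; lra.
(* Half of the room above n/2, so that the exponent q = 1 - a - e of the error integral still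
   exceeds n/2. *)
pose eta := (1 - a - n%:R / 2) / 2.
pose e := Num.min 1 eta.
have e0 : 0 < e by rewrite lt_min ltr01 /eta; lra.
have e1 : e <= 1 by rewrite ge_min lexx.
have ee : e <= eta by rewrite ge_min lexx orbT.
pose q := 1 - a - e.
have nq : n%:R / 2 < q by rewrite /q; move: ee; rewrite /eta; lra.
have domq := dominated_weight_powR D0 k0 nq.
pose c2 := 4 * k * (4 * expR 1) ^+ 2.
(* The first term comes from the gradient of the cutoff, the second from the mass that it
   removes. *)
pose T := 2 * M ^+ 2 * c2 + 4 * th * M ^+ 2.
pose Iq := \int[rvm n]_x (W x `^ (- q)).
have aE : a - 1 = - (1 - a) by ring.
have dgc := dominated_bounded_weight cgc gM2' np; rewrite -aE in dgc.
have dG := dominated_sqgrad_weight D0 k0 a sg bg.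
(* The limit rho to infinity, read as: the inequality holds up to y T Iq for each y > 0, where y =
   rho^-e. *)
suff main y : 0 < y -> th * \int[rvm n]_x ((g x - c) ^+ 2 * W x `^ (a - 1)) <=
    2 * \int[rvm n]_x (sqgrad g x * W x `^ a) +
    b * D `^ (a - 1) * \int[rvm n]_(x in @cube R r n) ((g x - c) ^+ 2) + y * (T * Iq).
  apply/ler_addgt0Pr => z z0.
  have T1 : 0 < `|T * Iq| + 1 by rewrite ltr_wpDl.
  apply: le_trans (main (z / (`|T * Iq| + 1)) _) _; first by rewrite divr_gt0.
  rewrite lerD2l mulrAC ler_pdivrMr// ler_pM2l//.
  by rewrite (le_trans (ler_norm _))// lerDl.
move=> y0.
pose rho := y `^ (- e^-1); have rh0 : 0 < rho by rewrite powR_gt0.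
have rhoE : rho `^ (- e) = y.
  by rewrite /rho -powRrM mulrNN mulVf ?gt_eqF// powRr1 ?ltW.
pose chi (x : 'rV[R]_n) := cutoff rho (W x).
have schi : smexpr chi by exact: smexpr_cutoff.
pose h (x : 'rV[R]_n) := (g x + - c) * chi x.
have sh : smooth h.
  apply: smexprW; apply: smexpr_mul => //.
  by apply: smexpr_add; [exact: smexpr_smooth|exact: smexpr_cst].
have bh : bounded_support h.
  have [B hB] := bounded_support_cutoff n D0 k0 rh0.
  by exists B => x Bx; rewrite /h /chi hB// mulr0.
have chi0 x : 0 <= chi x by exact: cutoff_ge0.
have chi1 x : chi x <= 1 by apply: cutoff_le1 => //; exact/ltW/weight_gt0.
have gradh x : sqgrad h x <= 2 * sqgrad g x + 2 * M ^+ 2 * sqgrad chi x.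
  have dh i : 'D_(dx i) h x = (g x - c) * 'D_(dx i) chi x + chi x * 'D_(dx i) g x.
    have dg : is_derive x (dx i) g ('D_(dx i) g x).
      by apply: DeriveDef => //; exact: smooth_derivable.
    have dchi : is_derive x (dx i) chi ('D_(dx i) chi x).
      by apply: DeriveDef => //; exact/smooth_derivable/smexprW.
    have [_] := is_deriveM (is_deriveD dg (is_derive_cst (- c) x (dx i))) dchi.
    by rewrite addr0 => <-.
  rewrite /sqgrad !mulr_sumr -big_split /=; apply: ler_sum => i _.
  rewrite dh; set G := 'D_(dx i) g x; set H := 'D_(dx i) chi x.
  have l1 : ((g x - c) * H) ^+ 2 <= M ^+ 2 * H ^+ 2.
    by rewrite exprMn ler_wpM2r ?sqr_ge0.
  have l2 : (chi x * G) ^+ 2 <= G ^+ 2.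
    by rewrite exprMn ler_piMl ?sqr_ge0// exprn_ile1.
  have := sqr_ge0 ((g x - c) * H - chi x * G).
  by lra.
have qE x : W x `^ (e - 1) * W x `^ a = W x `^ (- q).
  by rewrite -gt0_powRD ?weight_gt0//; congr (_ `^ _); rewrite /q; ring.
have gradhW x : sqgrad h x * W x `^ a <=
    2 * (sqgrad g x * W x `^ a) + 2 * M ^+ 2 * c2 * y * W x `^ (- q).
  have := sqgrad_cutoff D0 k0 x rh0 (ltW e0) e1; rewrite rhoE -/c2 -/chi => hc.
  apply: (@le_trans _ _ ((2 * sqgrad g x + 2 * M ^+ 2 * (c2 * y * W x `^ (e - 1))) * W x `^ a)).
    apply: ler_wpM2r; first exact: powR_ge0.
    rewrite (le_trans (gradh x))// lerD2l ler_wpM2l ?mulr_ge0 ?sqr_ge0//.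
  by rewrite -qE le_eqVlt; apply/orP; left; apply/eqP; ring.
have lowh x : (g x - c) ^+ 2 * W x `^ (a - 1) - 4 * M ^+ 2 * y * W x `^ (- q) <=
    h x ^+ 2 * W x `^ (a - 1).
  have W0 := weight_gt0 D0 k0 x.
  have := cutoff_tail rh0 W0 (ltW e0) e1.
  have -> : (W x / rho) `^ e = y * W x `^ e.
    rewrite powRM ?invr_ge0 ?(ltW W0) ?(ltW rh0)// mulrC -rhoE.
    by rewrite (powR_invl _ (ltW rh0)).
  have -> : W x `^ (- q) = W x `^ e * W x `^ (a - 1).
    by rewrite -gt0_powRD//; congr (_ `^ _); rewrite /q; ring.
  rewrite /h -/(chi x) => ht.
  have : (g x - c) ^+ 2 * (1 - chi x ^+ 2) <= M ^+ 2 * (4 * (y * W x `^ e)).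
    apply: ler_pM => //; first exact: sqr_ge0.
    by rewrite subr_ge0 exprn_ile1.
  move/(ler_wpM2r (powR_ge0 (W x) (a - 1))); rewrite -[g x + - c]/(g x - c).
  move: (W x `^ (a - 1)) (W x `^ e) (g x - c) (chi x) => A B u X.
  by rewrite exprMn; lra.
(* The extension by zero need not be continuous, hence need not be [dominated]; its integrability
   comes from boundedness on a cube of finite volume. *)
pose U := ((fun x : rVm R n => (g x - c) ^+ 2) \_ (@cube R r n)).
have iU : (rvm n).-integrable setT (EFin \o U) by exact: integrable_cube_bounded cgc gM2'.
pose w0 (x : 'rV[R]_n) := h x ^+ 2 * (W x `^ (a - 2) * (lam * n%:R * D + lam ^+ 2 * sqnorm x)).
have dw0 : dominated w0.
  have ch := smooth_continuous sh.
  apply: bounded_support_dominated; last first.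
    by apply: bounded_supportMr; have [B hB] := bh; exists B => x Bx; rewrite hB// expr0n.
  apply: continuousM_rv; first exact: continuousM_rv.
  apply: continuousM_rv; first exact: continuous_weight_powR.
  move=> x; apply: (@cvgD _ _ _ (nbhs x)); first exact: cvg_cst.
  by apply: (@cvgM _ _ (nbhs x)); [exact: cvg_cst|exact: continuous_sqnorm].
have dh2 := dominated_sqr_weight D0 k0 (a - 1) sh bh.
have dgh := dominated_sqgrad_weight D0 k0 a sh bh.
have S1 : th * \int[rvm n]_x (h x ^+ 2 * W x `^ (a - 1)) <=
    \int[rvm n]_x w0 x + b * D `^ (a - 1) * \int[rvm n]_x U x.
  rewrite -dominated_RintegralZ// -RintegralZl//.
  have ib : (rvm n).-integrable setT (EFin \o (fun x => b * D `^ (a - 1) * U x)).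
    rewrite (_ : _ \o _ = (fun x => (b * D `^ (a - 1))%:E * (EFin \o U) x)%E).
      exact: integrableZl.
    by apply/funext.
  rewrite -RintegralD//; last exact: dominated_integrable.
  apply: le_Rintegral => //.
  - by apply: dominated_integrable; exact: dominatedZ.
  - exact: (integrableD measurableT (dominated_integrable dw0) ib).
  move=> x _; have [l1 l2] := hardy_weight_ge x r0 rE.
  have hh : h x ^+ 2 <= (g x - c) ^+ 2.
    by rewrite exprMn ler_piMr ?sqr_ge0// exprn_ile1.
  have [xQ|xQ] := pselect (@cube R r n x).
    rewrite /U patchE mem_set//.
    apply: (le_trans (y := h x ^+ 2 * (W x `^ (a - 2) *
        (lam * n%:R * D + lam ^+ 2 * sqnorm x) + b * D `^ (a - 1)))).
      by rewrite mulrCA; apply: ler_wpM2l; [exact: sqr_ge0|exact: l1].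
    rewrite mulrDr lerD2l mulrC ler_wpM2l//.
    by rewrite mulr_ge0 ?powR_ge0// ltW.
  rewrite /U patchE memNset// mulr0 addr0 /w0 mulrCA.
  by apply: ler_wpM2l; [exact: sqr_ge0|exact: l2].
have S2 := @hardy_weight R n D k a D0 k0 h sh bh; rewrite -/lam in S2.
have S3 : \int[rvm n]_x (sqgrad h x * W x `^ a) <=
    2 * \int[rvm n]_x (sqgrad g x * W x `^ a) + 2 * M ^+ 2 * c2 * y * Iq.
  rewrite /Iq -!dominated_RintegralZ// -dominated_RintegralD; [|exact: dominatedZ..].
  by apply: dominated_le_Rintegral => //; apply: dominatedD; exact: dominatedZ.
have S4 : \int[rvm n]_x ((g x - c) ^+ 2 * W x `^ (a - 1)) - 4 * M ^+ 2 * y * Iq <=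
    \int[rvm n]_x (h x ^+ 2 * W x `^ (a - 1)).
  rewrite /Iq -mulNr -dominated_RintegralZ// -dominated_RintegralD//; last exact: dominatedZ.
  apply: dominated_le_Rintegral => //; first by apply: dominatedD => //; exact: dominatedZ.
  by move=> x; have := lowh x; rewrite mulNr.
rewrite [X in _ + b * _ * X]Rintegral_mkcond -/U.
have S4' := ler_wpM2l (ltW th0) S4.
have -> : y * (T * Iq) = 2 * M ^+ 2 * c2 * y * Iq + th * (4 * M ^+ 2 * y * Iq).
  by rewrite /T; ring.
exact: le_absorb S1 S2 S3 S4'.
Qed.

End fixed_D.

(** D cancels because r^2 = kap D: the Poincare constant of the cube, of order r^2, turns D^(a-1)
    into D^a, and D^a is comparable to W^a on the cube, where D <= W <= D w1. *)
Lemma poincare_const : exists C : R, 0 < C /\ forall D : R, 0 < D ->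
  forall g : 'rV[R]_n -> R, smooth g -> bounded_support g ->
  \int[rvm n]_x ((g x - (\int[rvm n]_x (g x * @weight R n D k x `^ (a - 1))) /
                        (\int[rvm n]_x (@weight R n D k x `^ (a - 1)))) ^+ 2 *
                 @weight R n D k x `^ (a - 1)) <=
  C * \int[rvm n]_x (sqgrad g x * @weight R n D k x `^ a).
Proof.
pose lam := (n%:R + 2 * a - 2) * k / 2; pose th := lam ^+ 2 / (2 * k).
pose b := th - lam * n%:R; pose kap := 2 * b / lam ^+ 2.
have lam0 : lam < 0 by rewrite /lam pmulr_llt0 ?invr_gt0// pmulr_llt0.
have lam2 : 0 < lam ^+ 2 by rewrite -sqrrN exprn_gt0// oppr_gt0.
have th0 : 0 < th by rewrite divr_gt0// mulr_gt0.
have n0 : 0 <= n%:R :> R by [].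
have b0 : 0 < b by rewrite ltr_pwDl// oppr_ge0 nmulr_rle0.
have kap0 : 0 < kap by rewrite divr_gt0// mulr_gt0.
pose w1 := 1 + k * (n%:R * kap).
have w10 : 0 < w1 by rewrite ltr_wpDr// mulr_ge0 ?(ltW k0)// mulr_ge0// (ltW kap0).
(* The factors come from the error b D^(a-1) on the cube, the Poincare constant 2^n (2r)^2 = 2^n 4
   kap D, and D^a <= w1^(-a) W^a. *)
pose B := b * (2 ^+ n * (4 * kap)) * w1 `^ (- a).
have B0 : 0 <= B by rewrite mulr_ge0 ?powR_ge0// mulr_ge0 ?(ltW b0)// mulr_ge0 ?exprn_ge0// mulr_ge0 ?(ltW kap0).
exists ((2 + B) / th); split; first by rewrite divr_gt0// ltr_wpDr.
move=> D D0 g sg bg; set W := @weight R n D k.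
set G := \int[rvm n]_x (sqgrad g x * W x `^ a).
pose r := Num.sqrt (kap * D).
have r0 : 0 < r by rewrite sqrtr_gt0 mulr_gt0.
have rE : r ^+ 2 = kap * D by rewrite sqr_sqrtr// mulr_ge0 ?(ltW kap0)// ltW.
rewrite mulrAC ler_pdivlMr// mulrC.
have mQ := @measurable_cube R r n.
have cg := smooth_continuous sg.
have bsq := bounded_support_sqgrad bg; have csq := continuous_sqgrad sg.
have [M1 gM1] := bounded_support_norm_le csq bsq.
have [M0 gM0] := bounded_support_norm_le cg bg.
pose S := ((sqgrad g : rVm R n -> R) \_ (@cube R r n)).
have iS : (rvm n).-integrable setT (EFin \o S) by exact: integrable_cube_bounded csq gM1.
have dG := dominated_sqgrad_weight D0 k0 a sg bg.
have SG : b * D `^ (a - 1) * (2 ^+ n * (2 * r) ^+ 2 * \int[rvm n]_x S x) <= B * G.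
  have -> : b * D `^ (a - 1) * (2 ^+ n * (2 * r) ^+ 2 * \int[rvm n]_x S x) =
      (b * (2 ^+ n * (4 * kap)) * D `^ a) * \int[rvm n]_x S x.
    have -> : D `^ a = D `^ (a - 1) * D.
      by rewrite -{3}(powRr1 (ltW D0)) -gt0_powRD// subrK.
    by rewrite exprMn rE; ring.
  rewrite /G -[X in _ <= X]dominated_RintegralZ// -RintegralZl//.
  apply: le_Rintegral => //.
  - rewrite (_ : _ \o _ = (fun x => (b * (2 ^+ n * (4 * kap)) * D `^ a)%:E * (EFin \o S) x)%E).
      exact: integrableZl.
    by apply/funext.
  - by apply: dominated_integrable; exact: dominatedZ.
  move=> x _; rewrite /S patchE; case: ifPn => [/set_mem xQ|_]; last first.
    by rewrite mulr0 mulr_ge0// mulr_ge0 ?powR_ge0 ?sqgrad_ge0.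
  rewrite /B -!(mulrA b) ler_pM2l// -!(mulrA (2 ^+ n)) ler_pM2l ?exprn_gt0//.
  suff key : D `^ a <= w1 `^ (- a) * W x `^ a.
    have sq0 : 0 <= 4 * kap * sqgrad g x.
      by rewrite mulr_ge0 ?sqgrad_ge0// mulr_ge0// (ltW kap0).
    have := ler_wpM2l sq0 key; move: (D `^ a) (w1 `^ (- a)) (W x `^ a) (sqgrad g x) => A1 A2 A3 A4.
    by congr (_ <= _); ring.
  have Wle : W x <= D * w1.
    rewrite /W /weight /w1 mulrDr mulr1 lerD2l mulrCA ler_pM2l//.
    rewrite mulrC -mulrA -rE /sqnorm (@le_trans _ _ (\sum_(i < n) r ^+ 2))//; last first.
      by rewrite sumr_const card_ord mulr_natl.
    apply: ler_sum => i _; rewrite -[leLHS]real_normK ?num_real//.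
    by rewrite lerXn2r ?nnegrE ?(ltW r0)//; exact: xQ.
  have W0 := weight_gt0 D0 k0 x.
  have := ler_powRN (_ : 0 <= - a) W0 Wle; rewrite opprK => /(_ _).
  rewrite powRM ?(ltW D0) ?(ltW w10)// => hW.
  have : D `^ a * w1 `^ a <= W x `^ a by apply: hW; move: a0; lra.
  move/(ler_wpM2l (powR_ge0 w1 (- a))); rewrite mulrCA -gt0_powRD// addNr powRr0 mulr1.
  by [].
apply/ler_addgt0Pr => z z0.
have c0 : 0 < b * D `^ (a - 1) by rewrite mulr_gt0 ?powR_gt0.
have C1g : C1 g.
  split=> // i; split; last exact: smooth_continuous_derive.
  by move=> x; exact: smooth_derivable.
(* This slack becomes exactly z after multiplication by b D^(a-1). *)
have [c Hc] := cube_poincare r0 C1g (divr_gt0 z0 c0).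
have -> : (2 + B) * G + z = 2 * G + (B * G + z) by ring.
have P1 := mean_deviation_le D0 c sg bg.
apply: le_trans (ler_wpM2l (ltW th0) P1) _.
apply: le_trans (poincare_cutoff D0 c sg bg r0 rE) _.
rewrite -/W -/G -/th -/b lerD2l.
have gM x : `|(g x - c) ^+ 2| <= (M0 + `|c|) ^+ 2.
  rewrite normrX lerXn2r ?nnegrE//; first by rewrite (le_trans (normr_ge0 _) (le_trans (gM0 0) _))// lerDl.
  by rewrite (le_trans (ler_normB _ _))// lerD2r.
have cgc : continuous (fun x => (g x - c) ^+ 2).
  have c1 : continuous (fun x => g x - c).
    by move=> x; apply: (@cvgB _ _ _ (nbhs x)); [exact: cg|exact: cvg_cst].
  exact: (@continuousM_rv R n _ _ c1 c1).
have iU := integrable_cube_bounded r0 cgc gM.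
have toR (f : rVm R n -> R) : (rvm n).-integrable setT (EFin \o (f \_ (@cube R r n))) ->
    (\int[rvm n]_(x in @cube R r n) (f x)%:E = (\int[rvm n]_x (f \_ (@cube R r n)) x)%:E)%E.
  move=> intf; rewrite /Rintegral fineK; last exact: (integrable_fin_num _ intf).
  by rewrite [LHS]integral_mkcond; apply: eq_integral => x _; rewrite !patchE; case: ifP.
move: Hc; rewrite (toR (fun x => (g x - c) ^+ 2))// (toR (sqgrad g))//.
have -> : ((2 ^+ n * (2 * r) ^+ 2)%:E * (\int[rvm n]_x S x)%:E + (z / (b * D `^ (a - 1)))%:E =
  (2 ^+ n * (2 * r) ^+ 2 * \int[rvm n]_x S x + z / (b * D `^ (a - 1)))%:E)%E by [].
rewrite lee_fin => Hc; rewrite [X in _ * X <= _]Rintegral_mkcond.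
apply: le_trans (ler_wpM2l (ltW c0) Hc) _.
rewrite mulrDr lerD//.
by rewrite mulrC divfK// gt_eqF.
Qed.

End poincare.

(** * Translation from m and V to the exponent a and the weight W *)

Section parameters.
Variables (R : realType) (d : nat) (m : R).
Hypotheses (m0 : 0 < m) (m1 : m < 1).
Local Notation a := (- (1 - m)^-1).
Local Notation k := ((1 - m) / (2 * m)).
Local Notation W D := (@weight R d D k).

Let im0 : 0 < 1 - m. Proof. by rewrite subr_gt0. Qed.

Let k0 : 0 < k. Proof. by rewrite divr_gt0// mulr_gt0. Qed.

(** Makes A = d + 2a - 2 negative for every d up to 4, whatever m is. *)
Lemma exponent_lt : a < - 1.
Proof.
by rewrite ltrN2 invf_gt1 ?ltrBlDr ?ltrDl.
Qed.

Lemma exponent_mstar : (2 < d)%N ->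
  (d%:R + 2 * a - 2) * (1 - m) = (d%:R - 2) * (mstar R d - m).
Proof.
move=> d2; have d0 : d%:R - 2 != 0 :> R.
  by rewrite subr_eq0 -[2]/(2%:R) eqr_nat gtn_eqF.
by rewrite /mstar; field; rewrite d0 gt_eqF.
Qed.

Lemma int_muE (D : R) (f : 'rV[R]_d -> R) : 0 < D ->
  int_mu m D f = iint (fun x => (f x * W D x `^ (a - 1))%:E).
Proof.
move=> D0; congr (iint _); apply/funext => x; congr ((_ * _)%:E).
rewrite /V -/(weight D k x) -powRrM; congr (_ `^ _).
by field; rewrite gt_eqF.
Qed.

Lemma dominated_mu (D : R) (f : 'rV[R]_d -> R) (M : R) : 0 < D ->
  d%:R + 2 * a - 2 < 0 -> continuous f -> (forall x, `|f x| <= M) ->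
  dominated (fun x => f x * W D x `^ (a - 1)).
Proof.
move=> D0 A0 cf fM; rewrite (_ : a - 1 = - (1 - a)); last by ring.
by apply: dominated_bounded_weight fM _ => //; move: A0; lra.
Qed.

Lemma int_nu_sqgrad (D : R) (g : 'rV[R]_d -> R) : 0 < D -> smooth g ->
  bounded_support g ->
  int_nu m D (sqgrad g) = (\int[rvm d]_x (sqgrad g x * W D x `^ a))%:E.
Proof.
by move=> D0 sg bg; rewrite -iint_Rintegral//; exact: dominated_sqgrad_weight.
Qed.

Lemma int_mu_sqr (D : R) (g : 'rV[R]_d -> R) : 0 < D -> smooth g ->
  bounded_support g ->
  int_mu m D (fun x => g x ^+ 2) = (\int[rvm d]_x (g x ^+ 2 * W D x `^ (a - 1)))%:E.
Proof.
by move=> D0 sg bg; rewrite int_muE// iint_Rintegral//; exact: dominated_sqr_weight.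
Qed.

Lemma int_mu1 (D : R) : 0 < D -> d%:R + 2 * a - 2 < 0 ->
  int_mu m D (fun _ : 'rV[R]_d => 1) = (\int[rvm d]_x (W D x `^ (a - 1)))%:E.
Proof.
move=> D0 A0; rewrite int_muE// iint_Rintegral; last first.
  apply: (@dominated_mu D (fun=> 1) 1 D0 A0); first exact: cst_continuous.
  by move=> x; rewrite normr1.
by congr (_%:E); apply: eq_Rintegral => x _; rewrite mul1r.
Qed.

Lemma int_mu_variance (D : R) (g : 'rV[R]_d -> R) : 0 < D ->
  d%:R + 2 * a - 2 < 0 -> smooth g -> bounded_support g ->
  int_mu m D (fun x => (g x - gbar m D g) ^+ 2) =
  (\int[rvm d]_x ((g x - (\int[rvm d]_x (g x * W D x `^ (a - 1))) /
                        (\int[rvm d]_x (W D x `^ (a - 1)))) ^+ 2 *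
                  W D x `^ (a - 1)))%:E.
Proof.
move=> D0 A0 sg bg; have cg := smooth_continuous sg.
have [M gM] := bounded_support_norm_le cg bg.
have mug : int_mu m D g = (\int[rvm d]_x (g x * W D x `^ (a - 1)))%:E.
  by rewrite int_muE// iint_Rintegral//; exact: dominated_mu D0 A0 cg gM.
rewrite /gbar mug int_mu1//= int_muE//.
set c := _ / _; rewrite iint_Rintegral//.
apply: (@dominated_mu D (fun x => (g x - c) ^+ 2) ((M + `|c|) ^+ 2) D0 A0).
  have c1 : continuous (fun x => g x - c).
    by move=> x; apply: (@cvgB _ _ _ (nbhs x)); [exact: cg|exact: cvg_cst].
  exact: (@continuousM_rv R d _ _ c1 c1).
move=> x; rewrite normrX lerXn2r ?nnegrE//.
  by rewrite addr_ge0//; exact: le_trans (normr_ge0 _) (gM 0).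
by rewrite (le_trans (ler_normB _ _))// lerD2r.
Qed.

End parameters.
Theorem theoremA1 (R : realType) (d : nat) (m : R) :
  (1 <= d)%N -> 0 < m -> m < 1 ->
  (* (a) *)
  (((d <= 4)%N \/ ((5 <= d)%N /\ mstar R d < m)) ->
     (forall D : R, 0 < D -> (int_mu m D (fun _ : 'rV[R]_d => 1%R) < +oo)%E) /\
     exists C : R, 0 < C /\
       forall D : R, 0 < D -> forall g : 'rV[R]_d -> R, Cc_infty g ->
         (int_mu m D (fun x => ((g x - gbar m D g) ^+ 2)%R)
           <= C%:E * int_nu m D (sqgrad g))%E) /\
  (* (b) *)
  (((5 <= d)%N /\ m < mstar R d) ->
     let C := 8 * m * (1 - m) / ((d%:R - 2) * (m - mstar R d)) ^+ 2 in
     (forall D : R, 0 < D -> forall g : 'rV[R]_d -> R, Cc_infty g ->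
        (int_mu m D (fun x => (g x ^+ 2)%R) <= C%:E * int_nu m D (sqgrad g))%E) /\
     (* optimality *)
     (forall D : R, 0 < D -> forall C' : R, C' < C ->
        exists g : 'rV[R]_d -> R, Cc_infty g /\
          (C'%:E * int_nu m D (sqgrad g) < int_mu m D (fun x => (g x ^+ 2)%R))%E)).

Proof.
move=> d1 m0 m1; pose a := - (1 - m)^-1; pose k := (1 - m) / (2 * m).
have im0 : 0 < 1 - m by rewrite subr_gt0.
have k0 : 0 < k by rewrite divr_gt0// mulr_gt0.
have a1 : a < - 1 := exponent_lt m0 m1.
split=> [hd|[d5 mlt] C].
  have A0 : d%:R + 2 * a - 2 < 0.
    case: hd => [d4|[d5 mgt]].
      have : d%:R <= 4 :> R by rewrite -[4]/(4%:R) ler_nat.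
      by lra.
    rewrite -(pmulr_llt0 _ im0) exponent_mstar//; last exact: ltn_trans d5.
    by rewrite pmulr_rlt0 ?subr_lt0// subr_gt0 -[2]/(2%:R) ltr_nat; exact: ltn_trans d5.
  split=> [D D0|]; first by rewrite int_mu1// ltry.
  have [C [C0 HC]] := poincare_const k0 (lt_trans a1 (ltrN10 R)) A0.
  exists C; split=> // D D0 g [sg /bounded_supportP bg].
  rewrite int_mu_variance// int_nu_sqgrad//.
  by rewrite -EFinM lee_fin; exact: HC.
have d2 : (2 < d)%N by exact: ltn_trans d5.
have d20 : 0 < d%:R - 2 :> R by rewrite subr_gt0 -[2]/(2%:R) ltr_nat.
have AE := exponent_mstar m1 d2; rewrite -/a in AE.
have A0 : 0 < d%:R + 2 * a - 2.
  by rewrite -(pmulr_lgt0 _ im0) AE mulr_gt0// subr_gt0.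
have CE : C = 4 / (k * (d%:R + 2 * a - 2) ^+ 2).
  rewrite /C -[m - _]opprB mulrN sqrrN -AE /k.
  by field; rewrite !gt_eqF.
have C0 : 0 < C by rewrite CE divr_gt0// mulr_gt0// exprn_gt0.
split=> D D0.
  move=> g [sg /bounded_supportP bg]; rewrite int_mu_sqr// int_nu_sqgrad//.
  rewrite -EFinM lee_fin CE; apply: hardy_upper => //.
  by rewrite ltW// (lt_trans a1)// ltr_pwDl.
(* C' may be negative, whereas [hardy_optimal] takes a nonnegative constant; enlarging C' only
   strengthens the claim, since the Dirichlet integral is nonnegative. *)
move=> C' C'C; pose C'' := Num.max C' 0.
have C''0 : 0 <= C'' by rewrite le_max lexx orbT.
have s00 : 0 < (d%:R + 2 * a - 2) / 4 by rewrite divr_gt0.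
(* At the critical exponent s0 = A/4 the factor 4 k s0^2 is exactly 1/C. *)
have Cs : C'' * (4 * k * ((d%:R + 2 * a - 2) / 4) ^+ 2) < 1.
  have -> : 4 * k * ((d%:R + 2 * a - 2) / 4) ^+ 2 = C^-1.
    by rewrite CE; field; rewrite !gt_eqF.
  by rewrite ltr_pdivrMr// mul1r gt_max C'C.
have [g [sg bg Hg]] := hardy_optimal D0 k0 s00 C''0 Cs.
exists g; split; first by split=> //; exact/bounded_supportP.
rewrite int_mu_sqr// int_nu_sqgrad// -EFinM lte_fin; apply: le_lt_trans Hg.
apply: ler_wpM2r; last by rewrite le_max lexx.
apply: Rintegral_ge0 => x _; rewrite mulr_ge0 ?powR_ge0//; exact: sqgrad_ge0.
Qed.
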